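(* Let $\mathcal{T}$ be a triangulated category and let $\omega$ be a semi-selforthogonal subcategory of $\mathcal{T}$. If $\mathcal{T}=\langle {}_{\omega}\mathcal{X}\rangle=\langle \mathcal{X}_{\omega}\rangle$, then there is a triangle equivalence between the stable category $\underline{\mathcal{G}_{\omega}}$ and the relative singularity category $\mathcal{T}_{\omega}$.
   Context: All subcategories are full. $\mathcal{T}$ is a triangulated category with shift functor $[1]$; ''$X\to Y\to Z\to$'' denotes a (distinguished) triangle $X\to Y\to Z\to X[1]$. For a subcategory $\mathcal{C}$, $\langle\mathcal{C}\rangle$ denotes the smallest triangulated subcategory of $\mathcal{T}$ containing $\mathcal{C}$. A subcategory $\omega\subseteq\mathcal{T}$ is semi-selforthogonal (also called presilting) if $\mathrm{Hom}_{\mathcal{T}}(M,M'[i])=0$ for all $M,M'\in\omega$ and all $i>0$. $\mathrm{add}\,\omega$ is the class of all direct summands of finite direct sums of copies of objects in $\omega$. ${}^{\perp}\omega$ is the class of all objects $N$ with $\mathrm{Hom}_{\mathcal{T}}(N,M[i])=0$ for all $M\in\omega$, $i>0$; $\omega^{\perp}$ is the class of all objects $N$ with $\mathrm{Hom}_{\mathcal{T}}(M,N[i])=0$ for all $M\in\omega$, $i>0$. The Auslander class $\mathcal{X}_{\omega}$ is the class of all objects $T$ for which there are triangles $T_i\to M_i\to T_{i+1}\to$ for all $i\ge 0$ with $T_0=T$, $M_i\in\mathrm{add}\,\omega$ and $T_i\in{}^{\perp}\omega$ for each $i\ge 0$. The co-Auslander class ${}_{\omega}\mathcal{X}$ is the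 class of all objects $T$ for which there are triangles $T_{i+1}\to M_i\to T_i\to$ for all $i\ge 0$ with $T_0=T$, $M_i\in\mathrm{add}\,\omega$ and $T_i\in\omega^{\perp}$ for each $i\ge 0$. The $\omega$-Gorenstein objects are the objects of $\mathcal{G}_{\omega}:={}_{\omega}\mathcal{X}\cap\mathcal{X}_{\omega}$. Put $\mathcal{D}=\mathrm{add}\,\omega$. The stable category is $\underline{\mathcal{G}_{\omega}}:=\mathcal{G}_{\omega}/[\mathcal{D}]$: it has the same objects as $\mathcal{G}_{\omega}$, and its morphisms are those of $\mathcal{G}_\omega$ modulo the morphisms factoring through objects of $\mathcal{D}$. It is a triangulated category with the structure of Iyama–Yoshino: for each $G\in\mathcal{G}_{\omega}$ choose a triangle $G\to D_G\to G\langle 1\rangle\to G[1]$ with $D_G\in\mathcal{D}$, $G\langle 1\rangle\in\mathcal{G}_{\omega}$; then $\langle 1\rangle$ induces the shift functor of $\underline{\mathcal{G}_{\omega}}$. For a triangle $X\to Y\to Z\to X[1]$ in $\mathcal{T}$ with $X,Y,Z\in\mathcal{G}_{\omega}$ there is a morphism of triangles, with identity on $X$ and $X[1]$, to $X\to D_X\to X\langle 1\rangle\to X[1]$, whose component $Z\to X\langle 1\rangle$ yields $X\to Y\to Z\to X\langle 1\rangle$; the triangles of $\underline{\mathcal{G}_{\omega}}$ are the sequences isomorphic in $\underline{\mathcal{G}_\omega}$ to those obtained in this way. The relative singularity category of $\mathcal{T}$ with respect to $\omega$ is the Verdier quotient $\mathcal{T}_{\omega}:=\mathcal{T}/\langle\mathrm{add}\,\omega\rangle$.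 *)

(* Defs.v *)
From HB Require Import structures.
From mathcomp Require Import all_boot all_algebra.
From mathcomp Require Import boolp.

Set Implicit Arguments.
Unset Strict Implicit.
Unset Printing Implicit Defensive.

Import GRing.Theory.
Local Open Scope ring_scope.
Local Open Scope quotient_scope.

Record preadditive := Preadditive {
  ob :> Type;
  hom : ob -> ob -> zmodType;
  idm : forall X, hom X X;
  comp : forall X Y Z, hom Y Z -> hom X Y -> hom X Z;
  compA : forall X Y Z W (h : hom Z W) (g : hom Y Z) (f : hom X Y),
    comp h (comp g f) = comp (comp h g) f;
  comp1m : forall X Y (f : hom X Y), comp (idm Y) f = f;
  compm1 : forall X Y (f : hom X Y), comp f (idm X) = f;
  compDl : forall X Y Z (g g' : hom Y Z) (f : hom X Y),
    comp (g + g') f = comp g f + comp g' f;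
  compDr : forall X Y Z (g : hom Y Z) (f f' : hom X Y),
    comp g (f + f') = comp g f + comp g f'
}.
Arguments idm {p} X : rename.
Arguments comp {p X Y Z} : rename.

Notation "g ∘ f" := (comp g f) (at level 40, left associativity) : ring_scope.

Record functor (C D : preadditive) := Functor {
  fob :> C -> D;
  fmap : forall X Y, hom X Y -> hom (fob X) (fob Y);
  fmap1 : forall X, fmap (idm X) = idm (fob X);
  fmapM : forall X Y Z (g : hom Y Z) (f : hom X Y),
    fmap (g ∘ f) = fmap g ∘ fmap f;
  fmapD : forall X Y (f f' : hom X Y), fmap (f + f') = fmap f + fmap f'
}.
Arguments fmap {C D} F {X Y} : rename.

Definition id_functor (C : preadditive) : functor C C :=
  @Functor C C id (fun _ _ f => f) (fun _ => erefl) (fun _ _ _ _ _ => erefl)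
    (fun _ _ _ _ => erefl).

Section CompFunctor.
Variables (C D E : preadditive) (G : functor D E) (F : functor C D).

Fact comp_fmap1 X : fmap G (fmap F (idm X)) = idm (G (F X)).
Proof. by rewrite !fmap1. Qed.
Fact comp_fmapM X Y Z (g : hom Y Z) (f : hom X Y) :
  fmap G (fmap F (g ∘ f)) = fmap G (fmap F g) ∘ fmap G (fmap F f).
Proof. by rewrite !fmapM. Qed.
Fact comp_fmapD X Y (f f' : hom X Y) :
  fmap G (fmap F (f + f')) = fmap G (fmap F f) + fmap G (fmap F f').
Proof. by rewrite !fmapD. Qed.

Definition comp_functor : functor C E :=
  @Functor C E (fun X => G (F X)) (fun _ _ f => fmap G (fmap F f))
    comp_fmap1 comp_fmapM comp_fmapD.
End CompFunctor.

Definition is_iso (C : preadditive) (X Y : C) (f : hom X Y) :=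
  exists g : hom Y X, g ∘ f = idm X /\ f ∘ g = idm Y.

Definition is_nat_iso (C D : preadditive) (F G : functor C D)
    (t : forall X, hom (F X) (G X)) :=
  (forall X Y (f : hom X Y), t Y ∘ fmap F f = fmap G f ∘ t X) /\
  (forall X, is_iso (t X)).

Definition nat_isomorphic (C D : preadditive) (F G : functor C D) :=
  exists t, @is_nat_iso C D F G t.

Definition is_equivalence (C D : preadditive) (F : functor C D) :=
  exists G : functor D C,
    nat_isomorphic (comp_functor G F) (id_functor C) /\
    nat_isomorphic (comp_functor F G) (id_functor D).

Definition is_zero_ob (C : preadditive) (Z : C) := idm Z = 0.

Definition is_dirsum (C : preadditive) (I : finType) (M : I -> C) (P : C) :=
  exists (i : forall k, hom (M k) P) (p : forall k, hom P (M k)),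
    [/\ forall k, p k ∘ i k = idm (M k),
        forall k l, k != l -> p k ∘ i l = 0
      & \sum_k (i k ∘ p k) = idm P].

Definition is_biprod (C : preadditive) (X Y P : C) :=
  is_dirsum (fun b : bool => if b then X else Y) P.

Definition is_summand (C : preadditive) (X P : C) :=
  exists Y, is_biprod X Y P.

Record pretriangulated := Pretriangulated {
  tcat :> preadditive;
  shift : functor tcat tcat;
  dist : forall X Y Z : tcat,
    hom X Y -> hom Y Z -> hom Z (shift X) -> Prop
}.
Arguments shift {p} : rename.
Arguments dist {p X Y Z} : rename.

Notation sh := (fmap shift).

(* As in the construction of stable categories, the shift is only required to
   be an autoequivalence, not an automorphism. *)
Record is_triangulated (T : pretriangulated) : Prop := IsTriangulated {
  tr_zero : exists Z : T, is_zero_ob Z;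
  tr_biprod : forall X Y : T, exists P, is_biprod X Y P;
  tr_shift : is_equivalence (@shift T);
  tr_iso : forall (X Y Z X' Y' Z' : T)
      (f : hom X Y) (g : hom Y Z) (h : hom Z (shift X))
      (f' : hom X' Y') (g' : hom Y' Z') (h' : hom Z' (shift X'))
      (a : hom X X') (b : hom Y Y') (c : hom Z Z'),
    is_iso a -> is_iso b -> is_iso c ->
    b ∘ f = f' ∘ a -> c ∘ g = g' ∘ b -> sh a ∘ h = h' ∘ c ->
    dist f g h -> dist f' g' h';
  tr_id : forall X Z : T, is_zero_ob Z -> dist (idm X) (0 : hom X Z) 0;
  tr_cone : forall (X Y : T) (f : hom X Y),
    exists (Z : T) (g : hom Y Z) (h : hom Z (shift X)), dist f g h;
  tr_rot : forall (X Y Z : T) (f : hom X Y) (g : hom Y Z) (h : hom Z (shift X)),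
    dist f g h <-> dist g h (- sh f);
  tr_map : forall (X Y Z X' Y' Z' : T)
      (f : hom X Y) (g : hom Y Z) (h : hom Z (shift X))
      (f' : hom X' Y') (g' : hom Y' Z') (h' : hom Z' (shift X'))
      (a : hom X X') (b : hom Y Y'),
    dist f g h -> dist f' g' h' -> b ∘ f = f' ∘ a ->
    exists c : hom Z Z', c ∘ g = g' ∘ b /\ sh a ∘ h = h' ∘ c;
  tr_oct : forall (X Y Z X' Y' Z' : T) (f : hom X Y) (g : hom Y Z)
      (u : hom Y Z') (u' : hom Z' (shift X))
      (v : hom Z X') (v' : hom X' (shift Y))
      (w : hom Z Y') (w' : hom Y' (shift X)),
    dist f u u' -> dist g v v' -> dist (g ∘ f) w w' ->
    exists (a : hom Z' Y') (b : hom Y' X'),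
      [/\ dist a b (sh u ∘ v'),
          a ∘ u = w ∘ g, w' ∘ a = u',
          b ∘ w = v & v' ∘ b = sh f ∘ w']
}.

Record triangulated := Triangulated {
  tdata :> pretriangulated;
  taxioms : is_triangulated tdata
}.

Record triangle_functor (A B : pretriangulated) := TriangleFunctor {
  tf_functor :> functor A B;
  tf_shift : forall X, hom (tf_functor (shift X)) (shift (tf_functor X));
  tf_shift_nat : is_nat_iso (F := comp_functor tf_functor shift)
                            (G := comp_functor shift tf_functor) tf_shift;
  tf_dist : forall (X Y Z : A) (f : hom X Y) (g : hom Y Z)
      (h : hom Z (shift X)),
    dist f g h ->
    dist (fmap tf_functor f) (fmap tf_functor g)
         (tf_shift X ∘ fmap tf_functor h)
}.

Definition triangle_equivalent (A B : pretriangulated) :=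
  exists F : triangle_functor A B, is_equivalence F.

(* Full subcategories are predicates on objects; closure under isomorphism is
   part of the definition of a triangulated subcategory. *)
Record is_trisub (T : pretriangulated) (N : T -> Prop) : Prop := IsTrisub {
  ts_zero : forall X, is_zero_ob X -> N X;
  ts_iso : forall (X Y : T) (f : hom X Y), is_iso f -> N X -> N Y;
  ts_shift : forall X, N X <-> N (shift X);
  ts_cone : forall (X Y Z : T) (f : hom X Y) (g : hom Y Z)
      (h : hom Z (shift X)),
    dist f g h -> N X -> N Y -> N Z
}.

Record trisub (T : pretriangulated) := Trisub {
  ts_pred :> T -> Prop;
  ts_axioms : is_trisub ts_pred
}.

Definition generated (T : pretriangulated) (C : T -> Prop) (X : T) : Prop :=
  forall N : trisub T, (forall Y, C Y -> N Y) -> N X.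

Fact generated_is_trisub (T : pretriangulated) (C : T -> Prop) :
  is_trisub (generated C).
Proof.
split.
- by move=> X X0 N _; exact: (ts_zero (ts_axioms N)).
- move=> X Y f fi hX N CN; exact: (ts_iso (ts_axioms N) fi (hX N CN)).
- move=> X; split=> hX N CN; first exact/(ts_shift (ts_axioms N) X)/hX.
  by apply/(ts_shift (ts_axioms N) X); exact: hX.
- move=> X Y Z f g h d hX hY N CN.
  exact: (ts_cone (ts_axioms N) d (hX N CN) (hY N CN)).
Qed.

Definition trispan (T : pretriangulated) (C : T -> Prop) : trisub T :=
  Trisub (generated_is_trisub C).

Section PreadditiveTheory.
Variable C : preadditive.
Implicit Types X Y Z : C.

Lemma comp0l X Y Z (f : hom X Y) : (0 : hom Y Z) ∘ f = 0.
Proof. by apply: (addrI (0 ∘ f)); rewrite -compDl !addr0. Qed.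
Lemma comp0r X Y Z (g : hom Y Z) : g ∘ (0 : hom X Y) = 0.
Proof. by apply: (addrI (g ∘ 0)); rewrite -compDr !addr0. Qed.
Lemma compNl X Y Z (g : hom Y Z) (f : hom X Y) : (- g) ∘ f = - (g ∘ f).
Proof. by apply: (addrI (g ∘ f)); rewrite -compDl !subrr comp0l. Qed.
Lemma compNr X Y Z (g : hom Y Z) (f : hom X Y) : g ∘ (- f) = - (g ∘ f).
Proof. by apply: (addrI (g ∘ f)); rewrite -compDr !subrr comp0r. Qed.
Lemma compBl X Y Z (g g' : hom Y Z) (f : hom X Y) :
  (g - g') ∘ f = g ∘ f - g' ∘ f.
Proof. by rewrite compDl compNl. Qed.
Lemma compBr X Y Z (g : hom Y Z) (f f' : hom X Y) :
  g ∘ (f - f') = g ∘ f - g ∘ f'.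
Proof. by rewrite compDr compNr. Qed.
Lemma comp_suml (I : finType) X Y Z (g : I -> hom Y Z) (f : hom X Y) :
  (\sum_k g k) ∘ f = \sum_k (g k ∘ f).
Proof. by apply: (big_morph (fun h => h ∘ f)) => [a b|]; rewrite ?compDl ?comp0l. Qed.
Lemma comp_sumr (I : finType) X Y Z (g : hom Y Z) (f : I -> hom X Y) :
  g ∘ (\sum_k f k) = \sum_k (g ∘ f k).
Proof. by apply: (big_morph (comp g)) => [a b|]; rewrite ?compDr ?comp0r. Qed.

Lemma to_zero X Z (f : hom X Z) : is_zero_ob Z -> f = 0.
Proof. by move=> Z0; rewrite -(comp1m f) Z0 comp0l. Qed.
Lemma from_zero X Z (f : hom Z X) : is_zero_ob Z -> f = 0.
Proof. by move=> Z0; rewrite -(compm1 f) Z0 comp0r. Qed.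

Lemma is_iso1 X : is_iso (idm X).
Proof. by exists (idm X); rewrite compm1. Qed.
Lemma is_isoN X Y (f : hom X Y) : is_iso f -> is_iso (- f).
Proof. by case=> g [gf fg]; exists (- g); rewrite !compNl !compNr !opprK. Qed.
Lemma is_isoM X Y Z (f : hom X Y) (g : hom Y Z) :
  is_iso f -> is_iso g -> is_iso (g ∘ f).
Proof.
move=> [f' [f'f ff']] [g' [g'g gg']]; exists (f' ∘ g'); split.
  by rewrite -compA [g' ∘ _]compA g'g comp1m.
by rewrite -compA [f ∘ _]compA ff' comp1m.
Qed.

End PreadditiveTheory.

Section FunctorTheory.
Variables (C D : preadditive) (F : functor C D).
Implicit Types X Y Z : C.

Lemma fmap0 X Y : fmap F (0 : hom X Y) = 0.
Proof. by apply: (addrI (fmap F 0)); rewrite -fmapD !addr0. Qed.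
Lemma fmapN X Y (f : hom X Y) : fmap F (- f) = - fmap F f.
Proof. by apply: (addrI (fmap F f)); rewrite -fmapD !subrr fmap0. Qed.
Lemma fmap_sum (I : finType) X Y (f : I -> hom X Y) :
  fmap F (\sum_k f k) = \sum_k fmap F (f k).
Proof. by apply: (big_morph (fmap F)) => [a b|]; rewrite ?fmapD ?fmap0. Qed.
Lemma fmap_iso X Y (f : hom X Y) : is_iso f -> is_iso (fmap F f).
Proof. by case=> g [gf fg]; exists (fmap F g); rewrite -!fmapM gf fg !fmap1. Qed.
Lemma fmap_zero Z : is_zero_ob Z -> is_zero_ob (F Z).
Proof. by rewrite /is_zero_ob -fmap1 => ->; rewrite fmap0. Qed.
Lemma fmap_dirsum (I : finType) (M : I -> C) P :
  is_dirsum M P -> is_dirsum (fun k => F (M k)) (F P).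
Proof.
case=> i [p [pi1 pi0 ip]]; exists (fun k => fmap F (i k)), (fun k => fmap F (p k)).
split=> [k|k l kl|]; first by rewrite -fmapM pi1 fmap1.
  by rewrite -fmapM pi0 ?fmap0.
by rewrite -fmap1 -ip fmap_sum; apply: eq_bigr => k _; rewrite fmapM.
Qed.

Lemma nat_iso_fullfaithful (G : functor D C) :
    nat_isomorphic (comp_functor G F) (id_functor C) ->
  forall X Y (f f' : hom X Y), fmap F f = fmap F f' -> f = f'.
Proof.
case=> t [nt it] X Y f f' e; have [s [st ts]] := it X.
have := nt _ _ f; rewrite /= e (nt _ _ f') /= => /(congr1 (fun h => h ∘ s)).
by rewrite -!compA ts !compm1.
Qed.

End FunctorTheory.

Section EquivalenceTheory.
Variables (C D : preadditive) (F : functor C D) (eF : is_equivalence F).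

Lemma equiv_faithful (X Y : C) (f f' : hom X Y) : fmap F f = fmap F f' -> f = f'.
Proof. by case: eF => G [/nat_iso_fullfaithful + _] => /[apply]. Qed.

Lemma equiv_full (X Y : C) (g : hom (F X) (F Y)) : exists f, g = fmap F f.
Proof.
case: eF => G [[t [nt it]] GF]; have [s [st ts]] := it X.
exists (t Y ∘ fmap G g ∘ s).
apply: (nat_iso_fullfaithful GF); have [s' [st' ts']] := it Y.
have := nt _ _ (t Y ∘ fmap G g ∘ s); rewrite /= => e.
have : t Y ∘ fmap G g = t Y ∘ fmap G (fmap F (t Y ∘ fmap G g ∘ s)).
  by rewrite e -!compA st compm1.
move=> /(congr1 (comp s')); rewrite !compA st' !comp1m.
by [].
Qed.

Lemma equiv_esurj (Y : D) : exists (X : C) (f : hom (F X) Y), is_iso f.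
Proof. by case: eF => G [_ [t [_ it]]]; exists (G Y), (t Y); exact: it. Qed.

End EquivalenceTheory.

Section DirectSums.
Variable C : preadditive.
Implicit Types X Y Z P Q : C.

Lemma biprodP X Y P : is_biprod X Y P <->
  exists (i : hom X P) (j : hom Y P) (p : hom P X) (q : hom P Y),
    [/\ p ∘ i = idm X, q ∘ j = idm Y, p ∘ j = 0, q ∘ i = 0 &
        i ∘ p + j ∘ q = idm P].
Proof.
split=> [[i [p [pi1 pi0 ip]]]|[i [j [p [q [pi qj pj qi ip]]]]]].
  exists (i true), (i false), (p true), (p false); split.
  - exact: (pi1 true).
  - exact: (pi1 false).
  - exact: (pi0 true false).
  - exact: (pi0 false true).
  - by rewrite -ip big_bool.
exists (fun b => match b return hom (if b then X else Y) P with
                 | true => i | false => j end),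
       (fun b => match b return hom P (if b then X else Y) with
                 | true => p | false => q end).
by split=> [[]|[] []|] //; rewrite big_bool.
Qed.

Lemma dirsum_sum (I J : finType) (M : I -> C) (N : J -> C) P P' Q :
    is_dirsum M P -> is_dirsum N P' -> is_biprod P P' Q ->
  is_dirsum (fun k => match k with inl a => M a | inr b => N b end) Q.
Proof.
move=> [i [p [pi1 pi0 ip]]] [i' [p' [pi1' pi0' ip']]].
move=> /biprodP[a [a' [b [b' [ba ba' bz bz' ab]]]]].
exists (fun k => match k return hom (match k with inl a => M a | inr b => N b end) Q
   with inl k => a ∘ i k | inr k => a' ∘ i' k end),
  (fun k => match k return hom Q (match k with inl a => M a | inr b => N b end)
   with inl k => p k ∘ b | inr k => p' k ∘ b' end).
split.
- case=> k; first by rewrite -compA [b ∘ _]compA ba comp1m pi1.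
  by rewrite -compA [b' ∘ _]compA ba' comp1m pi1'.
- case=> k [] l kl.
  + by rewrite -compA [b ∘ _]compA ba comp1m pi0.
  + by rewrite -compA [b ∘ _]compA bz comp0l comp0r.
  + by rewrite -compA [b' ∘ _]compA bz' comp0l comp0r.
  + by rewrite -compA [b' ∘ _]compA ba' comp1m pi0'.
- rewrite big_sumType /= -ab -[in RHS](comp1m b) -ip -[in RHS](comp1m b') -ip'.
  rewrite !comp_suml !comp_sumr; congr (_ + _);
  by apply: eq_bigr => k _; rewrite !compA.
Qed.

End DirectSums.

Section TriangulatedTheory.
Variable T : triangulated.
Implicit Types X Y Z W : T.
Let ax := taxioms T.

Lemma sh_faithful X Y (f f' : hom X Y) : sh f = sh f' -> f = f'.
Proof. exact: equiv_faithful (tr_shift ax) _ _ _ _. Qed.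

Lemma sh_full X Y (g : hom (shift X) (shift Y)) : exists f, g = sh f.
Proof. exact: equiv_full (tr_shift ax) _ _ _. Qed.

Lemma dist_rot X Y Z (f : hom X Y) (g : hom Y Z) h :
  dist f g h -> dist g h (- sh f).
Proof. by move=> /(tr_rot ax). Qed.

Lemma dist_invrot Y Z (g : hom Y Z) : exists X (f : hom X Y) h, dist f g h.
Proof.
have [E [p [r d]]] := tr_cone ax g.
have [X [t it]] := equiv_esurj (tr_shift ax) E; have [t' [t't tt']] := it.
have [f ef] := sh_full (r ∘ t).
exists X, (- f), (t' ∘ p); apply/(tr_rot ax); rewrite fmapN opprK.
apply: (tr_iso ax (is_iso1 Y) (is_iso1 Z) (c := t') _ _ _ _ d).
- by exists t.
- by rewrite comp1m compm1.
- by rewrite compm1.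
- by rewrite fmap1 comp1m -ef -compA tt' compm1.
Qed.

Lemma dist_comp0 X Y Z (f : hom X Y) (g : hom Y Z) h : dist f g h -> g ∘ f = 0.
Proof.
move=> d; have [O O0] := tr_zero ax.
have [c [+ _]] := tr_map ax (a := idm X) (b := f) (tr_id ax X O0) d erefl.
by rewrite comp0r.
Qed.

Lemma dist_wcoker X Y Z (f : hom X Y) (g : hom Y Z) h W (a : hom Y W) :
  dist f g h -> a ∘ f = 0 -> exists b, a = b ∘ g.
Proof.
move=> d af; have [O O0] := tr_zero ax.
have dW : dist (0 : hom O W) (idm W) 0.
  apply/(tr_rot ax); rewrite fmap0 oppr0; apply: (tr_id ax).
  exact: fmap_zero.
have [|b [+ _]] := tr_map ax (a := 0) (b := a) d dW; first by rewrite af comp0r.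
by rewrite comp1m => <-; exists b.
Qed.

Lemma dist_wker X Y Z (f : hom X Y) (g : hom Y Z) h W (a : hom W Y) :
  dist f g h -> g ∘ a = 0 -> exists b, a = f ∘ b.
Proof.
move=> d ga; have [O O0] := tr_zero ax.
have := dist_rot (tr_id ax W O0) => dW.
have [|c [_]] := tr_map ax (a := a) (b := 0) dW (dist_rot d); first by rewrite ga comp0l.
have [b ->] := sh_full c.
rewrite fmap1 compNr compNl compm1 -fmapM => /oppr_inj/sh_faithful ->.
by exists b.
Qed.

Lemma dist_shift X Y Z (f : hom X Y) (g : hom Y Z) h :
  dist f g h -> dist (sh f) (sh g) (- sh h).
Proof.
move=> /dist_rot/dist_rot/dist_rot d.
have iN (V : T) : is_iso (- idm V) by apply/is_isoN/is_iso1.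
apply: (tr_iso ax (iN _) (is_iso1 _) (iN _) _ _ _ d).
- by rewrite !compNr comp1m compm1.
- by rewrite compNl compNr opprK comp1m compm1.
- by rewrite fmapN fmap1 !compNl !compNr comp1m compm1.
Qed.

Lemma dist_iter X Y Z (f : hom X Y) (g : hom Y Z) h n : dist f g h ->
  exists (f' : hom (iter n shift X) (iter n shift Y))
         (g' : hom (iter n shift Y) (iter n shift Z)) h', dist f' g' h'.
Proof.
move=> d; elim: n => [|n [f' [g' [h' d']]]]; first by exists f, g, h.
by exists (sh f'), (sh g'), (- sh h'); exact: dist_shift.
Qed.

Lemma iter_dirsum n (I : finType) (M : I -> T) P :
  is_dirsum M P -> is_dirsum (fun k => iter n shift (M k)) (iter n shift P).
Proof. by move=> s; elim: n => // n /(fmap_dirsum shift). Qed.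

End TriangulatedTheory.

Section TrisubTheory.
Variables (T : triangulated) (N : trisub T).
Implicit Types X Y Z W : T.
Let ax := taxioms T.
Let nx := ts_axioms N.

Lemma ts_ext X Y Z (f : hom X Y) (g : hom Y Z) h :
  dist f g h -> N X -> N Z -> N Y.
Proof.
move=> /dist_rot/dist_rot/(ts_cone nx) d NX NZ.
by apply/(ts_shift nx Y); apply: d => //; apply/(ts_shift nx X).
Qed.

Lemma ts_fib X Y Z (f : hom X Y) (g : hom Y Z) h :
  dist f g h -> N Y -> N Z -> N X.
Proof. by move=> /dist_rot/(ts_cone nx) d NY NZ; apply/(ts_shift nx X); exact: d. Qed.

Definition qis X Y (s : hom X Y) : Prop :=
  exists Z (g : hom Y Z) h, dist s g h /\ N Z.

Lemma qisP X Y Z (s : hom X Y) (g : hom Y Z) h : dist s g h -> qis s -> N Z.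
Proof.
move=> d [Z' [g' [h' [d' NZ']]]]; have [O O0] := tr_zero ax.
have ds : dist (idm Y ∘ s) g h by rewrite comp1m.
have [a [b [d3 _ _ _ _]]] := tr_oct ax d' (tr_id ax Y O0) ds.
exact: ts_ext d3 NZ' (ts_zero nx O0).
Qed.

Lemma qis1 X : qis (idm X).
Proof.
have [O O0] := tr_zero ax; exists O, 0, 0; split; first exact: (tr_id ax).
exact: (ts_zero nx).
Qed.

Lemma qisM X Y Z (s : hom X Y) (t : hom Y Z) : qis s -> qis t -> qis (t ∘ s).
Proof.
move=> [A [u [u' [d NA]]]] [B [v [v' [d' NB]]]].
have [E [w [w' d2]]] := tr_cone ax (t ∘ s).
have [a [b [d3 _ _ _ _]]] := tr_oct ax d d' d2.
by exists E, w, w'; split => //; exact: ts_ext d3 NA NB.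
Qed.

Lemma qis_cancel X Y Z (s : hom X Y) (t : hom Y Z) :
  qis t -> qis (t ∘ s) -> qis s.
Proof.
move=> [B [v [v' [d' NB]]]] [E [w [w' [d2 NE]]]].
have [A [u [u' d]]] := tr_cone ax s.
have [a [b [d3 _ _ _ _]]] := tr_oct ax d d' d2.
by exists A, u, u'; split => //; exact: ts_fib d3 NE NB.
Qed.

Lemma qis_shift X Y (s : hom X Y) : qis s -> qis (sh s).
Proof.
move=> [Z [g [h [d NZ]]]]; exists (shift Z), (sh g), (- sh h); split.
  exact: dist_shift.
by apply/(ts_shift nx Z).
Qed.

Lemma qis_ore X Y Z (s : hom Y Z) (f : hom X Z) : qis s ->
  exists W (t : hom W X) (g : hom W Y), qis t /\ s ∘ g = f ∘ t.
Proof.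
move=> [A [q [r [d NA]]]].
have [W [t [k d']]] := dist_invrot (q ∘ f).
have [|g e] := dist_wker (a := f ∘ t) d.
  by rewrite compA (dist_comp0 d').
by exists W, t, g; split => //; exists A, (q ∘ f), k.
Qed.

Lemma qis_zero X Y Z (s : hom Y Z) (f : hom X Y) : qis s -> s ∘ f = 0 ->
  exists W (t : hom W X), qis t /\ f ∘ t = 0.
Proof.
move=> qs sf; have [A [k [l d]]] := dist_invrot s.
have NA : N A by apply/(ts_shift nx A); exact: (qisP (dist_rot d) qs).
have [b fb] := dist_wker d sf.
have [W [t [m d']]] := dist_invrot b.
exists W, t; split; first by exists A, b, m.
by rewrite fb -compA (dist_comp0 d') comp0r.
Qed.

End TrisubTheory.

(* [verdier N] is the Verdier quotient T/N: morphisms are equivalence classes of roofs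
   X <- W -> Y whose left leg has a cone in [N], the shift acts on both legs,
   and the triangles are the sequences isomorphic to images of triangles. *)

Section Verdier.
Variables (T : triangulated) (N : trisub T).
Implicit Types X Y Z W : T.
Let ax := taxioms T.
Local Notation qis := (qis N).

Record roof X Y := Roof {
  roof_ob : T;
  roof_den : hom roof_ob X;
  roof_num : hom roof_ob Y;
  roof_qis : qis roof_den
}.

HB.instance Definition _ X Y := gen_eqMixin (roof X Y).
HB.instance Definition _ X Y := gen_choiceMixin (roof X Y).

Definition roof_equiv X Y (r r' : roof X Y) : Prop :=
  exists W (u : hom W (roof_ob r)) (v : hom W (roof_ob r')),
    [/\ roof_den r ∘ u = roof_den r' ∘ v,
        roof_num r ∘ u = roof_num r' ∘ v & qis (roof_den r ∘ u)].

Definition roof_rel X Y : rel (roof X Y) := fun r r' => `[< roof_equiv r r' >].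

Fact roof_rel_refl X Y : reflexive (@roof_rel X Y).
Proof.
move=> r; apply/asboolP; exists (roof_ob r), (idm _), (idm _).
by split => //; rewrite compm1; exact: roof_qis.
Qed.

Fact roof_rel_sym X Y : symmetric (@roof_rel X Y).
Proof.
suff H r r' : @roof_rel X Y r r' -> roof_rel r' r by move=> r r'; apply/idP/idP; exact: H.
move=> /asboolP[W [u [v [e e' q]]]]; apply/asboolP; exists W, v, u.
by split => //; rewrite -e.
Qed.

Fact roof_rel_trans X Y : transitive (@roof_rel X Y).
Proof.
move=> r' r r'' /asboolP[W [u [v [e1 e2 q]]]] /asboolP[W' [u' [v' [e1' e2' q']]]].
apply/asboolP.
have [V [t [g [qt e]]]] := qis_ore (roof_den r ∘ u) q'.
have [|V' [k [qk ek]]] := qis_zero (f := u' ∘ g - v ∘ t) (roof_qis r').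
  by rewrite compBr !compA e e1 subrr.
move/eqP: ek; rewrite compBl subr_eq0 => /eqP ek.
exists V', (u ∘ t ∘ k), (v' ∘ g ∘ k); split.
- by rewrite !compA -e e1'.
- by rewrite !compA e2 -!compA [v ∘ (_ ∘ _)]compA -ek !compA e2'.
- by rewrite !compA; apply: qisM qk _; apply: qisM qt q.
Qed.

Canonical roof_equivRel X Y :=
  EquivRel (@roof_rel X Y) (@roof_rel_refl X Y) (@roof_rel_sym X Y) (@roof_rel_trans X Y).

Definition vhom_type X Y := {eq_quot (@roof_rel X Y)}.
HB.instance Definition _ X Y := Choice.on (vhom_type X Y).

Definition frac W X Y (s : hom W X) (q : qis s) (f : hom W Y) : vhom_type X Y :=
  \pi_(vhom_type X Y) (Roof f q).

Lemma frac_surj X Y (a : vhom_type X Y) :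
  exists W (s : hom W X) (q : qis s) (f : hom W Y), a = frac q f.
Proof. by elim/quotW: a => -[W s f q]; exists W, s, q, f. Qed.

Lemma fracE X Y W W' (s : hom W X) (q : qis s) (f : hom W Y)
    (s' : hom W' X) (q' : qis s') (f' : hom W' Y) :
  frac q f = frac q' f' <-> exists V (u : hom V W) (v : hom V W'),
    [/\ s ∘ u = s' ∘ v, f ∘ u = f' ∘ v & qis (s ∘ u)].
Proof.
by split=> [/eqmodP/asboolP //|e]; apply/eqmodP/asboolP.
Qed.

Lemma frac_ext X Y W V (s : hom W X) (q : qis s) (f : hom W Y) (t : hom V W)
    (st : hom V X) (q' : qis st) (ft : hom V Y) :
  st = s ∘ t -> ft = f ∘ t -> frac q f = frac q' ft.
Proof.
move=> e e'; apply/fracE; exists V, t, (idm V).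
by rewrite !compm1 -e -e'.
Qed.

Arguments frac_ext {X Y W V s q f t st q' ft}.

Lemma frac_eq X Y W (s : hom W X) (q : qis s) (f f' : hom W Y) :
  frac q f = frac q f' <-> exists V (t : hom V W), qis t /\ f ∘ t = f' ∘ t.
Proof.
split=> [/fracE[V [u [v [e e' qu]]]]|[V [t [qt e]]]]; last first.
  by apply/fracE; exists V, t, t; split => //; exact: qisM qt q.
have [|V' [k [qk ek]]] := qis_zero (f := u - v) q.
  by rewrite compBr e subrr.
move/eqP: ek; rewrite compBl subr_eq0 => /eqP ek.
exists V', (u ∘ k); split; last by rewrite {2}ek !compA e'.
exact: qisM qk (qis_cancel q qu).
Qed.

Lemma qis_common X W W' (s : hom W X) (s' : hom W' X) : qis s -> qis s' ->
  exists V (u : hom V W) (v : hom V W'),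
    [/\ s ∘ u = s' ∘ v, qis u & qis (s ∘ u)].
Proof.
move=> q q'; have [V [t [g [qt e]]]] := qis_ore s q'.
by exists V, t, g; split => //; exact: qisM qt q.
Qed.

Lemma frac_common X Y Y' (a : vhom_type X Y) (b : vhom_type X Y') :
  exists W (s : hom W X) (q : qis s) f g, a = frac q f /\ b = frac q g.
Proof.
have [W [s [q [f ->]]]] := frac_surj a; have [W' [s' [q' [f' ->]]]] := frac_surj b.
have [V [u [v [e _ qu]]]] := qis_common q q'.
exists V, (s ∘ u), qu, (f ∘ u), (f' ∘ v).
by split; apply: frac_ext => //.
Qed.

Lemma frac_common3 X Y (a b c : vhom_type X Y) :
  exists W (s : hom W X) (q : qis s) f g h,
    [/\ a = frac q f, b = frac q g & c = frac q h].
Proof.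
have [W [s [q [f [g [-> ->]]]]]] := frac_common a b.
have [W' [s' [q' [h ->]]]] := frac_surj c.
have [V [u [v [e _ qu]]]] := qis_common q q'.
exists V, (s ∘ u), qu, (f ∘ u), (g ∘ u), (h ∘ v).
by split; apply: frac_ext => //.
Qed.

Fact vadd_ex X Y (a b : vhom_type X Y) : exists c : vhom_type X Y,
  forall W (s : hom W X) (q : qis s) f g,
    a = frac q f -> b = frac q g -> c = frac q (f + g).
Proof.
have [W [s [q [f [g [-> ->]]]]]] := frac_common a b.
exists (frac q (f + g)) => W' s' q' f' g' e1 e2.
have [V [u [v [e qu qsu]]]] := qis_common q q'.
have ef : frac qsu (f ∘ u) = frac qsu (f' ∘ v).
  by rewrite -(frac_ext (q := q) (q' := qsu)  erefl erefl) e1; exact: (frac_ext (q := q') (q' := qsu)  e erefl).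
have eg : frac qsu (g ∘ u) = frac qsu (g' ∘ v).
  by rewrite -(frac_ext (q := q) (q' := qsu)  erefl erefl) e2; exact: (frac_ext (q := q') (q' := qsu)  e erefl).
rewrite (frac_ext (q := q) (q' := qsu) (f := f + g)  erefl erefl).
rewrite (frac_ext (q := q') (q' := qsu) (f := f' + g')  e erefl).
have [A [t [qt et]]] := (frac_eq qsu _ _).1 ef.
have [B [t' [qt' et']]] := (frac_eq qsu _ _).1 eg.
have [D [k [l [ekl qk qtk]]]] := qis_common qt qt'.
apply/frac_eq; exists D, (t ∘ k); split => //.
rewrite !compDl; congr (_ + _); first by rewrite !compA et.
by rewrite ekl !compA et'.
Qed.

Definition vadd X Y (a b : vhom_type X Y) : vhom_type X Y :=
  sval (cid (vadd_ex a b)).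

Lemma vaddE X Y W (s : hom W X) (q : qis s) (f g : hom W Y) :
  vadd (frac q f) (frac q g) = frac q (f + g).
Proof. by rewrite /vadd; case: cid => /= c /(_ _ _ q f g); exact. Qed.

Definition vzero X Y : vhom_type X Y := frac (qis1 N X) 0.

Lemma vzeroE X Y W (s : hom W X) (q : qis s) : vzero X Y = frac q 0.
Proof. by apply: (frac_ext (t := s)); rewrite ?comp1m ?comp0l. Qed.

Fact vopp_ex X Y (a : vhom_type X Y) : exists b, vadd b a = vzero X Y.
Proof.
have [W [s [q [f ->]]]] := frac_surj a; exists (frac q (- f)).
by rewrite vaddE addNr -vzeroE.
Qed.

Definition vopp X Y (a : vhom_type X Y) : vhom_type X Y :=
  sval (cid (vopp_ex a)).

Fact vaddA X Y : associative (@vadd X Y).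
Proof.
move=> a b c; have [W [s [q [f [g [h [-> -> ->]]]]]]] := frac_common3 a b c.
by rewrite !vaddE addrA.
Qed.
Fact vaddC X Y : commutative (@vadd X Y).
Proof.
move=> a b; have [W [s [q [f [g [-> ->]]]]]] := frac_common a b.
by rewrite !vaddE addrC.
Qed.
Fact vadd0 X Y : left_id (vzero X Y) (@vadd X Y).
Proof.
move=> a; have [W [s [q [f ->]]]] := frac_surj a.
by rewrite (vzeroE Y q) vaddE add0r.
Qed.
Fact vaddN X Y : left_inverse (vzero X Y) (@vopp X Y) (@vadd X Y).
Proof. by move=> a; rewrite /vopp; case: cid. Qed.

HB.instance Definition _ X Y :=
  GRing.isZmodule.Build (vhom_type X Y) (@vaddA X Y) (@vaddC X Y) (@vadd0 X Y)
    (@vaddN X Y).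

Definition vhom X Y : zmodType := vhom_type X Y.

Lemma fracD X Y W (s : hom W X) (q : qis s) (f g : hom W Y) :
  (frac q (f + g) : vhom X Y) = (frac q f : vhom X Y) + frac q g.
Proof. by rewrite -[RHS]/(vadd _ _) vaddE. Qed.

(* Composition: (f' s'^-1) (f s^-1) = (f' g) (s t)^-1 whenever s' g = f t. *)
Fact vcomp_ex X Y Z (b : vhom Y Z) (a : vhom X Y) : exists c : vhom X Z,
  forall W W' V (s : hom W X) (q : qis s) (f : hom W Y)
      (s' : hom W' Y) (q' : qis s') (f' : hom W' Z)
      (t : hom V W) (g : hom V W') (qst : qis (s ∘ t)),
    a = frac q f -> b = frac q' f' -> qis t -> s' ∘ g = f ∘ t ->
    c = frac qst (f' ∘ g).
Proof.
have [W [s [q [f ->]]]] := frac_surj a; have [W' [s' [q' [f' ->]]]] := frac_surj b.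
have [V [t [g [qt e]]]] := qis_ore f q'.
exists (frac (qisM qt q) (f' ∘ g)).
move=> W1 W1' V1 s1 q1 f1 s1' q1' f1' t1 g1 qst1.
move=> /fracE[U [u [v [esu efu qsu]]]] /fracE[U' [u' [v' [esu' efu' qsu']]]] qt1 e1.
have [A0 [k0 [a0 [qk0 ek0]]]] := qis_ore u qt.
have [A1 [k1 [b1 [qk1 ek1]]]] := qis_ore (v ∘ k0) qt1.
have qu' : qis u' := qis_cancel q' qsu'.
have [A2 [k2 [l [qk2 ek2]]]] := qis_ore (g ∘ a0 ∘ k1) qu'.
have [|A3 [k3 [qk3 ek3]]] := qis_zero (f := g1 ∘ b1 ∘ k2 - v' ∘ l) q1'.
  rewrite compBr !compA e1 -esu' -!compA ek2 [t1 ∘ _]compA ek1 !compA e.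
  by rewrite -efu -[f ∘ t ∘ a0]compA ek0 !compA subrr.
move/eqP: ek3; rewrite compBl subr_eq0 => /eqP ek3.
apply/fracE; exists A3, (a0 ∘ k1 ∘ k2 ∘ k3), (b1 ∘ k2 ∘ k3).
have e3 : s ∘ t ∘ (a0 ∘ k1 ∘ k2 ∘ k3) = s ∘ u ∘ (k0 ∘ k1 ∘ k2 ∘ k3).
  by rewrite -!compA [t ∘ (a0 ∘ _)]compA ek0 !compA.
split.
- rewrite e3 esu -!compA; congr (s1 ∘ _).
  by rewrite !compA ek1.
- rewrite -!compA [g1 ∘ _]compA [g1 ∘ b1 ∘ _]compA ek3.
  rewrite !compA -efu' -[f' ∘ u' ∘ l]compA ek2.
  by rewrite !compA.
- rewrite e3; apply: (qisM _ qsu).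
  by do 3!apply: qisM => //.
Qed.

Definition vcomp X Y Z (b : vhom Y Z) (a : vhom X Y) : vhom X Z :=
  sval (cid (vcomp_ex b a)).

Lemma vcompE X Y Z W W' V (s : hom W X) (q : qis s) (f : hom W Y)
    (s' : hom W' Y) (q' : qis s') (f' : hom W' Z)
    (t : hom V W) (g : hom V W') (qst : qis (s ∘ t)) :
  qis t -> s' ∘ g = f ∘ t ->
  vcomp (frac q' f') (frac q f) = frac qst (f' ∘ g).
Proof.
move=> qt e; rewrite /vcomp; case: cid => /= c Hc.
exact: Hc erefl erefl qt e.
Qed.

Definition loc X Y (f : hom X Y) : vhom X Y := frac (qis1 N X) f.

Lemma vcomp_loc X Y Z W (g : hom Y Z) (s : hom W X) (q : qis s) (f : hom W Y) :
  vcomp (loc g) (frac q f) = frac q (g ∘ f).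
Proof.
have q1 : qis (s ∘ idm W) by rewrite compm1.
rewrite /loc (vcompE q (qis1 N Y) g (g := f) q1) ?compm1 ?comp1m //; last exact: qis1.
by symmetry; apply: (frac_ext (t := idm W)); rewrite ?compm1.
Qed.

Fact vcompA X Y Z A (h : vhom Z A) (g : vhom Y Z) (f : vhom X Y) :
  vcomp h (vcomp g f) = vcomp (vcomp h g) f.
Proof.
have [W [s [q [f1 ->]]]] := frac_surj f.
have [W' [s' [q' [f2 ->]]]] := frac_surj g.
have [W'' [s'' [q'' [f3 ->]]]] := frac_surj h.
have [V3 [t3 [g3 [qt3 e3]]]] := qis_ore f2 q''.
have qst3 := qisM qt3 q'.
rewrite (vcompE q' q'' f3 qst3 qt3 e3).
have [V4 [t4 [g4 [qt4 e4]]]] := qis_ore f1 qst3.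
have qst4 := qisM qt4 q.
rewrite (vcompE q qst3 (f3 ∘ g3) qst4 qt4 e4).
rewrite (vcompE q q' f2 (g := t3 ∘ g4) qst4 qt4); last by rewrite compA.
have qst5 : qis (s ∘ t4 ∘ idm V4) by rewrite compm1.
rewrite (vcompE qst4 q'' f3 (g := g3 ∘ g4) qst5); last 2 first.
- exact: qis1.
- by rewrite compm1 !compA e3.
by symmetry; apply: (frac_ext (t := idm V4)); rewrite ?compm1 ?compA.
Qed.

Fact vcomp1m X Y (f : vhom X Y) : vcomp (loc (idm Y)) f = f.
Proof.
have [W [s [q [f1 ->]]]] := frac_surj f.
by rewrite vcomp_loc comp1m.
Qed.

Fact vcompm1 X Y (f : vhom X Y) : vcomp f (loc (idm X)) = f.
Proof.
have [W [s [q [f1 ->]]]] := frac_surj f.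
have q1 : qis (idm X ∘ s) by rewrite comp1m.
rewrite /loc (vcompE (qis1 N X) q f1 (g := idm W) q1 q) ?compm1 ?comp1m //.
by symmetry; apply: (frac_ext (t := idm W)); rewrite ?compm1 ?comp1m.
Qed.

Fact vcompDl X Y Z (g g' : vhom Y Z) (f : vhom X Y) :
  vcomp (g + g') f = vcomp g f + vcomp g' f.
Proof.
have [W' [s' [q' [h [h' [-> ->]]]]]] := frac_common g g'.
have [W [s [q [f1 ->]]]] := frac_surj f.
have [V [t [k [qt e]]]] := qis_ore f1 q'.
rewrite -fracD.
by rewrite !(vcompE q q' _ (qisM qt q) qt e) compDl fracD.
Qed.

Fact vcompDr X Y Z (g : vhom Y Z) (f f' : vhom X Y) :
  vcomp g (f + f') = vcomp g f + vcomp g f'.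
Proof.
have [W [s [q [h [h' [-> ->]]]]]] := frac_common f f'.
have [W' [s' [q' [g1 ->]]]] := frac_surj g.
have [V1 [t1 [k1 [qt1 e1]]]] := qis_ore h q'.
have [V2 [t2 [k2 [qt2 e2]]]] := qis_ore (h' ∘ t1) q'.
have qt := qisM qt2 qt1.
have e : s' ∘ (k1 ∘ t2) = h ∘ (t1 ∘ t2) by rewrite !compA e1.
have e' : s' ∘ k2 = h' ∘ (t1 ∘ t2) by rewrite e2 compA.
have e'' : s' ∘ (k1 ∘ t2 + k2) = (h + h') ∘ (t1 ∘ t2).
  by rewrite compDr e e' compDl.
rewrite -fracD (vcompE q q' g1 (qisM qt q) qt e'').
rewrite (vcompE q q' g1 (qisM qt q) qt e) (vcompE q q' g1 (qisM qt q) qt e').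
by rewrite compDr fracD.
Qed.

Definition vcat : preadditive :=
  Preadditive vcompA vcomp1m vcompm1 vcompDl vcompDr.

Fact locM X Y Z (g : hom Y Z) (f : hom X Y) :
  loc (g ∘ f) = vcomp (loc g) (loc f).
Proof. by rewrite vcomp_loc. Qed.

Fact locD X Y (f f' : hom X Y) : loc (f + f') = (loc f : vhom X Y) + loc f'.
Proof. exact: fracD. Qed.

Definition vloc : functor T vcat :=
  @Functor T vcat id loc (fun _ => erefl) locM locD.

Fact vshift_ex X Y (a : vhom X Y) : exists b : vhom (shift X) (shift Y),
  forall W (s : hom W X) (q : qis s) f,
    a = frac q f -> b = frac (qis_shift q) (sh f).
Proof.
have [W [s [q [f ->]]]] := frac_surj a; exists (frac (qis_shift q) (sh f)).
move=> W' s' q' f' /fracE[V [u [v [e e' qu]]]].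
apply/fracE; exists (shift V), (sh u), (sh v).
by rewrite -!fmapM e e'; split => //; rewrite -e; exact: qis_shift.
Qed.

Definition vshift_map X Y (a : vhom X Y) : vhom (shift X) (shift Y) :=
  sval (cid (vshift_ex a)).

Lemma vshiftE X Y W (s : hom W X) (q : qis s) (f : hom W Y) :
  vshift_map (frac q f) = frac (qis_shift q) (sh f).
Proof. by rewrite /vshift_map; case: cid => /= b /(_ _ _ q f); exact. Qed.

Fact vshift1 X : vshift_map (loc (idm X)) = loc (idm (shift X)).
Proof.
rewrite vshiftE; apply/esym.
by apply: (frac_ext (t := idm _)); rewrite compm1 fmap1.
Qed.

Fact vshiftM X Y Z (g : vhom Y Z) (f : vhom X Y) :
  vshift_map (vcomp g f) = vcomp (vshift_map g) (vshift_map f).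
Proof.
have [W [s [q [f1 ->]]]] := frac_surj f.
have [W' [s' [q' [g1 ->]]]] := frac_surj g.
have [V [t [k [qt e]]]] := qis_ore f1 q'.
rewrite (vcompE q q' g1 (qisM qt q) qt e) !vshiftE.
have qs := qisM (qis_shift qt) (qis_shift q).
rewrite (vcompE _ _ _ (g := sh k) qs); last 2 first.
- exact: qis_shift.
- by rewrite -!fmapM e.
by apply: (frac_ext (t := idm _)); rewrite ?compm1 !fmapM.
Qed.

Fact vshiftD X Y (f f' : vhom X Y) :
  vshift_map (f + f') = vshift_map f + vshift_map f'.
Proof.
have [W [s [q [h [h' [-> ->]]]]]] := frac_common f f'.
by rewrite -fracD !vshiftE fmapD fracD.
Qed.

Definition vshift : functor vcat vcat :=
  @Functor vcat vcat (fun X => shift (X : T)) vshift_map vshift1 vshiftM vshiftD.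

Definition vdist (X Y Z : vcat) (f : hom X Y) (g : hom Y Z)
    (h : hom Z (vshift X)) : Prop :=
  exists (X' Y' Z' : T) (f' : hom X' Y') (g' : hom Y' Z')
      (h' : hom Z' (shift X')) (a : hom (vloc X') X) (b : hom (vloc Y') Y)
      (c : hom (vloc Z') Z),
    [/\ dist f' g' h', is_iso a /\ is_iso b /\ is_iso c,
        b ∘ fmap vloc f' = f ∘ a, c ∘ fmap vloc g' = g ∘ b
      & fmap vshift a ∘ fmap vloc h' = h ∘ c].

Definition verdier : pretriangulated := Pretriangulated vdist.

End Verdier.

Section Gorenstein.
Variables (T : triangulated) (w : T -> Prop).
Implicit Types (X Y Z G : T) (i : nat).

Definition semi_selforthogonal : Prop :=
  forall M M', w M -> w M' ->
  forall i, (0 < i)%N -> forall f : hom M (iter i shift M'), f = 0.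

Definition add X : Prop :=
  exists (I : finType) (M : I -> T) (P : T),
    [/\ forall k, w (M k), is_dirsum M P & is_summand X P].

(* [lperp] is ${}^{\perp}\omega$, [rperp] is $\omega^{\perp}$, [auslander] is
   $\mathcal{X}_{\omega}$ and [coauslander] is ${}_{\omega}\mathcal{X}$. *)
Definition lperp X : Prop :=
  forall M, w M ->
  forall i, (0 < i)%N -> forall f : hom X (iter i shift M), f = 0.

Definition rperp X : Prop :=
  forall M, w M ->
  forall i, (0 < i)%N -> forall f : hom M (iter i shift X), f = 0.

Definition auslander X : Prop :=
  exists S M : nat -> T, S 0%N = X /\
    forall i, [/\ add (M i), lperp (S i)
      & exists (f : hom (S i) (M i)) (g : hom (M i) (S i.+1))
               (h : hom (S i.+1) (shift (S i))), dist f g h].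

Definition coauslander X : Prop :=
  exists S M : nat -> T, S 0%N = X /\
    forall i, [/\ add (M i), rperp (S i)
      & exists (f : hom (S i.+1) (M i)) (g : hom (M i) (S i))
               (h : hom (S i) (shift (S i.+1))), dist f g h].

Definition gorenstein X : Prop := coauslander X /\ auslander X.

Definition gorenstein_ob := {X : T | gorenstein X}.

Lemma add_zero X : is_zero_ob X -> add X.
Proof.
move=> X0; exists void, (@of_void T), X; split=> [[]||].
  exists (fun v : void => match v with end), (fun v : void => match v with end).
  by split=> [[]|[]|]; rewrite X0 big_pred0 // => -[].
exists X; apply/biprodP; exists 0, 0, 0, 0.
by rewrite !comp0l addr0 !X0.
Qed.

Lemma add_biprod X Y P : is_biprod X Y P -> add X -> add Y -> add P.
Proof.
move=> /biprodP[i [j [p [q [pi qj pj qi ip]]]]].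
move=> [I [M [PX [wM sM [X' /biprodP[iX [jX [pX [qX [pXi qXj pXj qXi iXp]]]]]]]]]].
move=> [J [N [PY [wN sN [Y' /biprodP[iY [jY [pY [qY [pYi qYj pYj qYi iYp]]]]]]]]]].
have [Q sQ] := tr_biprod (taxioms T) PX PY.
have [R sR] := tr_biprod (taxioms T) X' Y'.
exists (I + J)%type, (fun k => match k with inl a => M a | inr b => N b end), Q.
split=> [[]//||]; first exact: dirsum_sum sM sN sQ.
exists R; apply/biprodP.
move: sQ sR => /biprodP[a [a' [b [b' [ba ba' bz bz' ab]]]]].
move=> /biprodP[c [c' [d [d' [dc dc' dz dz' cd]]]]].
exists (a ∘ iX ∘ p + a' ∘ iY ∘ q), (a ∘ jX ∘ d + a' ∘ jY ∘ d'),
  (i ∘ pX ∘ b + j ∘ pY ∘ b'), (c ∘ qX ∘ b + c' ∘ qY ∘ b').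
have H (A1 A2 B1 B2 Z1 Z2 : T) (x : hom PX Z1) (y : hom PY Z1)
    (x' : hom Z2 PX) (y' : hom Z2 PY) :
    (x ∘ b + y ∘ b') ∘ (a ∘ x' + a' ∘ y') = x ∘ x' + y ∘ y'.
  rewrite compDl !compDr -!compA ![b ∘ (_ ∘ _)]compA ![b' ∘ (_ ∘ _)]compA.
  by rewrite ba ba' bz bz' !comp0l !comp1m !comp0r addr0 add0r.
have H' := H X X X X; rewrite -!(compA a) -!(compA a') {H}.
split.
- rewrite H' // -!compA [pX ∘ _]compA pXi [pY ∘ _]compA pYi !comp1m.
  exact: ip.
- rewrite H' // -!compA [qX ∘ _]compA qXj [qY ∘ _]compA qYj !comp1m.
  exact: cd.
- by rewrite H' // -!compA [pX ∘ _]compA pXj [pY ∘ _]compA pYj !comp0l !comp0r addr0.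
- by rewrite H' // -!compA [qX ∘ _]compA qXi [qY ∘ _]compA qYi !comp0l !comp0r addr0.
- rewrite !compDl !compDr -!compA.
  rewrite ![p ∘ (_ ∘ _)]compA ![q ∘ (_ ∘ _)]compA ![d ∘ (_ ∘ _)]compA ![d' ∘ (_ ∘ _)]compA.
  rewrite pi qj pj qi dc dc' dz dz' !comp0l !comp1m !comp0r !addr0 !add0r.
  rewrite -ab -[in RHS](comp1m b) -[in RHS](comp1m b') -iXp -iYp.
  rewrite !compDl !compDr -!compA.
  by rewrite addrACA.
Qed.

Lemma summand_retract X P : is_summand X P ->
  exists (i : hom X P) (p : hom P X), p ∘ i = idm X.
Proof. by case=> Y /biprodP[i [_ [p [_ [e _ _ _ _]]]]]; exists i, p. Qed.

Lemma iter_retract n X P (i : hom X P) (p : hom P X) : p ∘ i = idm X ->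
  exists (i' : hom (iter n shift X) (iter n shift P))
         (p' : hom (iter n shift P) (iter n shift X)), p' ∘ i' = idm _.
Proof.
move=> e; elim: n => [|n [i' [p' e']]]; first by exists i, p.
by exists (sh i'), (sh p'); rewrite -fmapM e' fmap1.
Qed.

Lemma lperp_add X D i (f : hom X (iter i shift D)) :
  lperp X -> add D -> (0 < i)%N -> f = 0.
Proof.
move=> lX [I [M [P [wM sM /summand_retract[a [b ba]]]]]] i0.
have [a' [b' ba']] := iter_retract i ba.
have [s [t [ts _ st]]] := iter_dirsum i sM.
rewrite -(comp1m f) -ba' -(comp1m a') -st !(comp_suml, comp_sumr) big1 // => k _.
have -> : s k ∘ t k ∘ a' = s k ∘ (t k ∘ a') by rewrite compA.
by rewrite -!compA (lX _ (wM k) i i0 (t k ∘ (a' ∘ f))) !comp0r.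
Qed.

Lemma rperp_add D : semi_selforthogonal -> add D -> rperp D.
Proof.
move=> ss [I [M [P [wM sM /summand_retract[a [b ba]]]]]] N wN i i0 f.
have [a' [b' ba']] := iter_retract i ba.
have [s [t [ts _ st]]] := iter_dirsum i sM.
rewrite -(comp1m f) -ba' -(comp1m a') -st !(comp_suml, comp_sumr) big1 // => k _.
by rewrite -!compA (ss _ _ wN (wM k) i i0 (t k ∘ (a' ∘ f))) !comp0r.
Qed.

Lemma rperp_cone X Y Z (f : hom X Y) (g : hom Y Z) h : dist f g h ->
  rperp X -> rperp Y -> rperp Z.
Proof.
move=> d rX rY M wM i i0 a.
have [f' [g' [h' d']]] := dist_iter i d.
have [|b ->] := dist_wker (a := a) (dist_rot d').
  exact: (rX M wM i.+1).
by rewrite (rY M wM i i0 b) comp0r.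
Qed.

Lemma gorenstein_shift G : semi_selforthogonal -> gorenstein G ->
  exists (D G' : T) (f : hom G D) (g : hom D G') (h : hom G' (shift G)),
    [/\ add D, gorenstein G' & dist f g h].
Proof.
move=> ss [[S' [M' [S'0 H']]] [S [M [S0 H]]]].
have [aM _ [f [g [h d]]]] := H 0%N; move: f h d; rewrite S0 => f h d.
exists (M 0%N), (S 1%N), f, g, h; split => //; split; last first.
  by exists (fun i => S i.+1), (fun i => M i.+1); split.
exists (fun i => if i is j.+1 then S' j else S 1%N),
       (fun i => if i is j.+1 then M' j else M 0%N); split => // -[|j].
  rewrite S'0; split => //; last by exists f, g, h.
  apply: (rperp_cone d); last exact: rperp_add.
  by rewrite -S'0; case: (H' 0%N).
exact: (H' j).
Qed.

End Gorenstein.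

(* [stable c] is G_ω/[add ω] with the structure of Iyama and Yoshino, relative
   to a choice [c] of triangles G -> D_G -> G<1> -> G[1]. *)

Record shift_choice (T : triangulated) (w : T -> Prop) := ShiftChoice {
  sc_D : gorenstein_ob w -> T;
  sc_shift : gorenstein_ob w -> gorenstein_ob w;
  sc_f : forall G, hom (sval G) (sc_D G);
  sc_g : forall G, hom (sc_D G) (sval (sc_shift G));
  sc_h : forall G, hom (sval (sc_shift G)) (shift (sval G));
  sc_add : forall G, add w (sc_D G);
  sc_dist : forall G, dist (sc_f G) (sc_g G) (sc_h G)
}.

(* So quantifying over all choices of triangles is not vacuous. *)
Lemma shift_choice_inhabited (T : triangulated) (w : T -> Prop) :
  semi_selforthogonal w -> inhabited (shift_choice w).
Proof.
move=> ss.
have H : forall G : gorenstein_ob w,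
    exists x : {D : T & {G' : gorenstein_ob w & (hom (sval G) D *
      hom D (sval G') * hom (sval G') (shift (sval G)))%type}},
    add w (projT1 x) /\ dist (projT2 (projT2 x)).1.1 (projT2 (projT2 x)).1.2
      (projT2 (projT2 x)).2.
  case=> G gG; have [D [G' [f [g [h [aD gG' d]]]]]] := gorenstein_shift ss gG.
  by exists (existT _ D (existT _ (exist _ G' gG') (f, g, h))).
have HF G := svalP (cid (H G)); constructor.
exact: (ShiftChoice (fun G => (HF G).1) (fun G => (HF G).2)).
Qed.

Section Stable.
Variables (T : triangulated) (w : T -> Prop) (c : shift_choice w).
Let ax := taxioms T.
Local Notation gob := (gorenstein_ob w).
Implicit Types X Y Z : T.
Implicit Types A B E : gob.

Definition factors X Y : {pred hom X Y} := fun f =>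
  `[< exists (D : T) (a : hom X D) (b : hom D Y), add w D /\ f = b ∘ a >].

Lemma factorsP X Y (f : hom X Y) : reflect
  (exists (D : T) (a : hom X D) (b : hom D Y), add w D /\ f = b ∘ a)
  (f \in @factors X Y).
Proof. exact: asboolP. Qed.

Fact factors_zmod X Y : zmod_closed (@factors X Y).
Proof.
split=> [|f f' /factorsP[D [a [b [aD ->]]]] /factorsP[D' [a' [b' [aD' ->]]]]];
  apply/factorsP.
  have [O O0] := tr_zero ax; exists O, 0, 0.
  by rewrite comp0r; split => //; exact: add_zero.
have [Q sQ] := tr_biprod ax D D'.
exists Q; move: (sQ) => /biprodP[i [j [p [q [pi qj pj qi _]]]]].
exists (i ∘ a + j ∘ a'), (b ∘ p - b' ∘ q); split; first exact: add_biprod sQ _ _.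
rewrite compBl !compDr -!compA ![p ∘ (_ ∘ _)]compA ![q ∘ (_ ∘ _)]compA.
by rewrite pi qj pj qi !comp0l !comp1m !comp0r addr0 add0r.
Qed.
HB.instance Definition _ X Y :=
  GRing.isZmodClosed.Build (hom X Y) (@factors X Y) (@factors_zmod X Y).

Lemma factors_compl X Y Z (g : hom Y Z) (f : hom X Y) :
  f \in @factors X Y -> g ∘ f \in @factors X Z.
Proof.
move=> /factorsP[D [a [b [aD ->]]]]; apply/factorsP.
by exists D, a, (g ∘ b); rewrite compA.
Qed.

Lemma factors_compr X Y Z (g : hom Y Z) (f : hom X Y) :
  g \in @factors Y Z -> g ∘ f \in @factors X Z.
Proof.
move=> /factorsP[D [a [b [aD ->]]]]; apply/factorsP.
by exists D, (a ∘ f), b; rewrite compA.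
Qed.

Definition shom A B : zmodType := Quotient.quot (@factors (sval A) (sval B)).

Definition spi A B (f : hom (sval A) (sval B)) : shom A B :=
  \pi_(Quotient.quot (@factors (sval A) (sval B))) f.

Lemma spiE A B (f f' : hom (sval A) (sval B)) :
  spi f = spi f' <-> f - f' \in @factors (sval A) (sval B).
Proof. by rewrite Quotient.idealrBE; split=> /eqP. Qed.

Lemma spi_surj A B (a : shom A B) : exists f, a = spi f.
Proof. by elim/quotW: a => f; exists f. Qed.

Lemma spiD A B (f f' : hom (sval A) (sval B)) : spi (f + f') = spi f + spi f'.
Proof. exact: raddfD. Qed.

Definition scomp A B E (g : shom B E) (f : shom A B) : shom A E :=
  spi (repr g ∘ repr f).

Lemma scompE A B E (g : hom (sval B) (sval E)) (f : hom (sval A) (sval B)) :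
  scomp (spi g) (spi f) = spi (g ∘ f).
Proof.
rewrite /scomp; apply/spiE.
have /spiE ef : spi (repr (spi f)) = spi f by exact: reprK.
have /spiE eg : spi (repr (spi g)) = spi g by exact: reprK.
rewrite -(subrKA (g ∘ repr (spi f))) -compBl -compBr.
by apply: rpredD; [exact: factors_compr|exact: factors_compl].
Qed.

Fact scompA A B E F (h : shom E F) (g : shom B E) (f : shom A B) :
  scomp h (scomp g f) = scomp (scomp h g) f.
Proof.
have [[h' ->] [g' ->] [f' ->]] := And3 (spi_surj h) (spi_surj g) (spi_surj f).
by rewrite !scompE compA.
Qed.
Fact scomp1m A B (f : shom A B) : scomp (spi (idm (sval B))) f = f.
Proof. by have [f' ->] := spi_surj f; rewrite scompE comp1m. Qed.
Fact scompm1 A B (f : shom A B) : scomp f (spi (idm (sval A))) = f.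
Proof. by have [f' ->] := spi_surj f; rewrite scompE compm1. Qed.
Fact scompDl A B E (g g' : shom B E) (f : shom A B) :
  scomp (g + g') f = scomp g f + scomp g' f.
Proof.
have [[h ->] [h' ->] [f' ->]] := And3 (spi_surj g) (spi_surj g') (spi_surj f).
by rewrite -spiD !scompE compDl spiD.
Qed.
Fact scompDr A B E (g : shom B E) (f f' : shom A B) :
  scomp g (f + f') = scomp g f + scomp g f'.
Proof.
have [[g' ->] [h ->] [h' ->]] := And3 (spi_surj g) (spi_surj f) (spi_surj f').
by rewrite -spiD !scompE compDr spiD.
Qed.

Definition scat : preadditive :=
  @Preadditive gob shom (fun A => spi (idm (sval A))) scomp
    scompA scomp1m scompm1 scompDl scompDr.

(* g : A<1> -> B<1> completes f : A -> B to a morphism of the chosen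
   triangles. *)
Definition completes A B (f : hom (sval A) (sval B))
    (g : hom (sval (sc_shift c A)) (sval (sc_shift c B))) : Prop :=
  exists x : hom (sc_D c A) (sc_D c B),
    [/\ x ∘ sc_f c A = sc_f c B ∘ f, g ∘ sc_g c A = sc_g c B ∘ x
      & sh f ∘ sc_h c A = sc_h c B ∘ g].

Lemma gorenstein_lperp A : lperp w (sval A).
Proof. by case: A => A /= [_ [S [M [<- /(_ 0%N)[]]]]]. Qed.

Lemma completes_ex A B (f : hom (sval A) (sval B)) : exists g, completes f g.
Proof.
have dA := sc_dist c A.
have h0 : sh (sc_f c B ∘ f) ∘ sc_h c A = 0.
  exact: (@lperp_add T w _ _ 1%N (sh (sc_f c B ∘ f) ∘ sc_h c A)
    (@gorenstein_lperp _) (sc_add c B)).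
have [b eb] := dist_wcoker (dist_rot (dist_rot dA)) h0.
have [b' eb'] := sh_full b.
have ex : - b' ∘ sc_f c A = sc_f c B ∘ f.
  by apply: sh_faithful; rewrite eb eb' compNr fmapM fmapN compNl.
have [g [e1 e2]] := tr_map ax dA (sc_dist c B) ex.
by exists g, (- b').
Qed.

Lemma completes_factors A B f g : @completes A B f g ->
  f \in @factors (sval A) (sval B) -> g \in @factors _ (sval (sc_shift c B)).
Proof.
move=> [_ [_ _ e3]] /factorsP[D [a [b [aD ef]]]].
have a0 : sh a ∘ sc_h c A = 0.
  exact: (@lperp_add T w _ _ 1%N (sh a ∘ sc_h c A) (@gorenstein_lperp _) aD).
have [|y ->] := dist_wker (a := g) (dist_rot (sc_dist c B)).
  by rewrite -e3 ef fmapM -compA a0 comp0r.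
by apply/factorsP; exists (sc_D c B), y, (sc_g c B); split => //; exact: sc_add.
Qed.

Lemma completesB A B f f' g g' : @completes A B f g -> completes f' g' ->
  completes (f - f') (g - g').
Proof.
move=> [x [e1 e2 e3]] [x' [e1' e2' e3']]; exists (x - x').
by rewrite fmapD fmapN !compBl !compBr e1 e2 e3 e1' e2' e3'.
Qed.

Lemma completesD A B f f' g g' : @completes A B f g -> completes f' g' ->
  completes (f + f') (g + g').
Proof.
move=> [x [e1 e2 e3]] [x' [e1' e2' e3']]; exists (x + x').
by rewrite fmapD !compDl !compDr e1 e2 e3 e1' e2' e3'.
Qed.

Fact sshift_ex A B (a : shom A B) : exists b : shom (sc_shift c A) (sc_shift c B),
  forall f g, a = spi f -> completes f g -> b = spi g.
Proof.
have [f ->] := spi_surj a; have [g fg] := completes_ex f.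
exists (spi g) => f' g' /spiE ff' fg'; apply/spiE.
exact: completes_factors (completesB fg fg') ff'.
Qed.

Definition sshift_map A B (a : shom A B) : shom (sc_shift c A) (sc_shift c B) :=
  sval (cid (sshift_ex a)).

Lemma sshiftE A B f g : @completes A B f g -> sshift_map (spi f) = spi g.
Proof. by move=> fg; rewrite /sshift_map; case: cid => /= b; apply. Qed.

Fact sshift1 A : sshift_map (idm (A : scat)) = spi (idm (sval (sc_shift c A))).
Proof.
by apply: sshiftE; exists (idm _); rewrite fmap1 !comp1m !compm1.
Qed.

Fact sshiftM A B E (g : shom B E) (f : shom A B) :
  sshift_map (scomp g f) = scomp (sshift_map g) (sshift_map f).
Proof.
have [[g1 ->] [f1 ->]] := conj (spi_surj g) (spi_surj f).
have [[g2 cg] [f2 cf]] := conj (completes_ex g1) (completes_ex f1).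
rewrite (sshiftE cg) (sshiftE cf) !scompE; apply: sshiftE.
case: cg cf => [y [y1 y2 y3]] [x [x1 x2 x3]]; exists (y ∘ x); split.
- by rewrite -compA x1 !compA y1.
- by rewrite -compA x2 !compA y2.
- by rewrite fmapM -compA x3 !compA y3.
Qed.

Fact sshiftD A B (f f' : shom A B) :
  sshift_map (f + f') = sshift_map f + sshift_map f'.
Proof.
have [[f1 ->] [f1' ->]] := conj (spi_surj f) (spi_surj f').
have [[f2 cf] [f2' cf']] := conj (completes_ex f1) (completes_ex f1').
rewrite (sshiftE cf) (sshiftE cf') -!spiD; apply: sshiftE.
exact: completesD.
Qed.

Definition sshift : functor scat scat :=
  @Functor scat scat (sc_shift c) sshift_map sshift1 sshiftM sshiftD.

(* The sequence A -> B -> E -> A<1> obtained from a triangle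
   (f, g, h) of T by means of a morphism of triangles (1, y, z). *)
Definition induced A B E (f : hom (A : scat) B) (g : hom (B : scat) E)
    (h : hom (E : scat) (sshift A)) : Prop :=
  exists (f0 : hom (sval A) (sval B)) (g0 : hom (sval B) (sval E))
      (h0 : hom (sval E) (shift (sval A)))
      (y : hom (sval B) (sc_D c A)) (z : hom (sval E) (sval (sc_shift c A))),
    [/\ dist f0 g0 h0, y ∘ f0 = sc_f c A, z ∘ g0 = sc_g c A ∘ y,
        sc_h c A ∘ z = h0 & [/\ f = spi f0, g = spi g0 & h = spi z]].

Definition sdist (A B E : scat) (f : hom A B) (g : hom B E)
    (h : hom E (sshift A)) : Prop :=
  exists (A' B' E' : scat) (f' : hom A' B') (g' : hom B' E')
      (h' : hom E' (sshift A')) (a : hom A' A) (b : hom B' B) (e : hom E' E),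
    [/\ induced f' g' h', is_iso a /\ is_iso b /\ is_iso e,
        b ∘ f' = f ∘ a, e ∘ g' = g ∘ b & fmap sshift a ∘ h' = h ∘ e].

Definition stable : pretriangulated := Pretriangulated sdist.

End Stable.

Definition relative_singularity (T : triangulated) (w : T -> Prop) :
    pretriangulated :=
  verdier (trispan (add w)).

(* Main.v *)
From mathcomp Require Import all_boot all_algebra.
From mathcomp Require Import boolp.
Require Import Defs.

Set Implicit Arguments.
Unset Strict Implicit.
Unset Printing Implicit Defensive.

Import GRing.Theory.
Local Open Scope ring_scope.

(** Write D for add ω, K for the triangulated span of D, and star A B for the
    class of the Y in a triangle X -> Y -> Z -> X[1] with X in A and Z in B.
    The functor sends a Gorenstein object to itself and the class of a morphism
    f to its image in T/K. It is a triangle functor because the connecting map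
    h : G<1> -> G[1] of a chosen triangle G -> D_G -> G<1> -> G[1] has its cone
    in K, hence becomes invertible in T/K. What remains is that the functor is
    fully faithful and dense.

    Everything rests on one fact about star ([star_star]): it is associative, by
    the octahedral axiom, and if every map from A to B[1] vanishes, then each
    extension in star B A splits and so lies in star A B. Hence extensions of
    objects of star A B can be sorted into an extension of star B B by star A A,
    and star A B is closed under extensions as soon as A and B are.

    Let lower and upper be the extension closures of the D[i] with i < 0 and
    with i > 0. Maps from lower to the right orthogonal of ω vanish, and so do
    maps from the left orthogonal to upper. Sorting then shows that each of
      star (star lower D) upper,  star X_ω upper,  star lower (coX_ω)
    is a triangulated subcategory; here X_ω and coX_ω denote the Auslander and
    co-Auslander classes. So the first contains K ([span_add_star]), and the
    other two contain, and by hypothesis are, all of T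
    ([span_auslander_star], [span_coauslander_star]).

    Density ([gorenstein_approximation]): an object X has a triangle
    A -> X -> U with A in X_ω and U in upper, and A has a triangle V -> A -> G
    with V in lower and G in coX_ω. Both U and V lie in K, so X and G are
    isomorphic in T/K. Moreover G is an extension of V[1] by A, and V[1] lies in
    X_ω, so G lies in X_ω as well and is Gorenstein.

    Full faithfulness ([loc_full], [loc_faithful]): a map from an object X of
    the left orthogonal to an object of K factors through an object Z of
    star lower D, since its component in upper vanishes. Maps from Z to Y[1],
    for Y in the right orthogonal, vanish too; so when Z is used as the cone of
    the denominator of a fraction from X to Y, the numerator extends along the
    denominator. If a map X -> Y becomes zero in T/K, then it factors through
    K, hence through such a Z, hence through D because its restriction to the
    lower part of Z vanishes. *)

(** * Isomorphisms and triangles *)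

Definition isomorphic (C : preadditive) (X Y : C) := exists f : hom X Y, is_iso f.

Section Isomorphic.
Variable C : preadditive.
Implicit Types X Y Z : C.

Lemma is_iso_sym X Y (f : hom X Y) : is_iso f ->
  exists g : hom Y X, [/\ is_iso g, g ∘ f = idm X & f ∘ g = idm Y].
Proof. by case=> g [gf fg]; exists g; split=> //; exists f. Qed.

Lemma isomorphic_sym X Y : isomorphic X Y -> isomorphic Y X.
Proof. by case=> f /is_iso_sym[g [ig _ _]]; exists g. Qed.

Lemma isomorphic_trans X Y Z : isomorphic X Y -> isomorphic Y Z -> isomorphic X Z.
Proof. by case=> f fi [g gi]; exists (g ∘ f); exact: is_isoM. Qed.

End Isomorphic.

Definition iso_closed (T : preadditive) (A : T -> Prop) :=
  forall X Y : T, isomorphic X Y -> A X -> A Y.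

Section Triangles.
Variable T : triangulated.
Implicit Types X Y Z : T.
Let ax := taxioms T.

Lemma nilpotent_iso X (e : hom X X) : e ∘ e = 0 -> is_iso (idm X + e).
Proof.
move=> e0; exists (idm X - e); split.
  by rewrite compBl comp1m compDr compm1 e0 addr0 addrK.
by rewrite compBr compm1 compDl comp1m e0 addr0 addrK.
Qed.

(** The difference c - 1 kills g on one side and h on the other, so it
    factors through h and its square is zero. *)
Lemma dist_endo_iso X Y Z (f : hom X Y) (g : hom Y Z) h (c : hom Z Z) :
  dist f g h -> c ∘ g = g -> h ∘ c = h -> is_iso c.
Proof.
move=> d cg hc; have -> : c = idm Z + (c - idm Z) by rewrite addrC subrK.
apply: nilpotent_iso.
have [|b eb] := dist_wcoker (a := c - idm Z) (dist_rot d).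
  by rewrite compBl comp1m cg subrr.
by rewrite {1}eb -compA compBr hc compm1 subrr comp0r.
Qed.

Lemma iso_factor (C : preadditive) (X Y : C) (f : hom X Y) (g : hom Y X) :
  is_iso (g ∘ f) -> is_iso (f ∘ g) -> is_iso f.
Proof.
move=> [u [ul _]] [v [_ vr]]; exists (u ∘ g); split; first by rewrite -compA.
have -> : u ∘ g = g ∘ v.
  by rewrite -[RHS]comp1m -ul -!compA [f ∘ (_ ∘ _)]compA vr compm1.
by rewrite compA.
Qed.

Lemma cone_unique X Y Z Z' (f : hom X Y) (g : hom Y Z) h (g' : hom Y Z') h' :
  dist f g h -> dist f g' h' -> isomorphic Z Z'.
Proof.
move=> d d'.
have map Z1 Z2 g1 h1 g2 h2 : @dist T _ _ Z1 f g1 h1 -> @dist T _ _ Z2 f g2 h2 ->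
    exists c : hom Z1 Z2, c ∘ g1 = g2 /\ h2 ∘ c = h1.
  move=> d1 d2; have [|c []] := tr_map ax (a := idm X) (b := idm Y) d1 d2.
    by rewrite comp1m compm1.
  by rewrite compm1 fmap1 comp1m => e1 e2; exists c.
have [c [cg hc]] := map _ _ _ _ _ _ d d'; have [c' [cg' hc']] := map _ _ _ _ _ _ d' d.
exists c; apply: (iso_factor (g := c')).
  by apply: (dist_endo_iso d); rewrite -?compA ?cg // compA hc' hc.
by apply: (dist_endo_iso d'); rewrite -?compA ?cg' // compA hc hc'.
Qed.

(** A section s of g exists because the connecting map is zero; the retraction
    r is the factorization of 1 - s g through f, which is a monomorphism for
    the same reason. *)
Lemma dist_split X Y Z (f : hom X Y) (g : hom Y Z) : dist f g 0 ->
  exists (s : hom Z Y) (r : hom Y X),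
    [/\ r ∘ f = idm X, g ∘ s = idm Z, r ∘ s = 0, g ∘ f = 0
      & f ∘ r + s ∘ g = idm Y].
Proof.
move=> d; have gf := dist_comp0 d.
have mono W (x : hom W X) : f ∘ x = 0 -> x = 0.
  move=> fx; apply: sh_faithful; rewrite fmap0.
  have [|b ->] := dist_wker (a := sh x) (dist_rot (dist_rot d)).
    by rewrite compNl -fmapM fx fmap0 oppr0.
  by rewrite comp0l.
have [|s es] := dist_wker (a := idm Z) (dist_rot d); first by rewrite comp0l.
have [|r er] := dist_wker (a := idm Y - s ∘ g) d.
  by rewrite compBr compA -es comp1m compm1 subrr.
exists s, r; split=> //; last by rewrite -er subrK.
- apply/eqP; rewrite -subr_eq0; apply/eqP/mono.
  by rewrite compBr compA -er compBl comp1m compm1 -compA gf comp0r subr0 subrr.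
- by apply: mono; rewrite compA -er compBl comp1m -compA -es compm1 subrr.
Qed.

(** In the cone of i the connecting map vanishes because i is split mono, so
    the projection q factors through the cone by an isomorphism. *)
Lemma biprod_dist X Y P (i : hom X P) (j : hom Y P) (p : hom P X) (q : hom P Y) :
  [/\ p ∘ i = idm X, q ∘ j = idm Y, p ∘ j = 0, q ∘ i = 0
    & i ∘ p + j ∘ q = idm P] -> dist i q 0.
Proof.
case=> pi qj pj qi e; have [Z [u [h d]]] := tr_cone ax i.
have h0 : h = 0.
  rewrite -(comp1m h) -fmap1 -pi fmapM -compA -(opprK (sh i ∘ h)) -compNl.
  by rewrite (dist_comp0 (dist_rot (dist_rot d))) oppr0 comp0r.
have [b qb] := dist_wcoker d qi.
have epi W (x : hom Z W) : x ∘ u = 0 -> x = 0.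
  by move=> /(dist_wcoker (dist_rot d))[y ->]; rewrite h0 comp0r.
apply: (tr_iso ax (is_iso1 X) (is_iso1 P) (c := b) _ _ _ _ d).
- exists (u ∘ j); split; last by rewrite compA -qb qj.
  apply/eqP; rewrite -subr_eq0; apply/eqP/epi.
  rewrite compBl comp1m -!compA -qb.
  have -> : j ∘ q = idm P - i ∘ p by rewrite -e addrC addKr.
  by rewrite compBr compm1 compA (dist_comp0 d) comp0l subr0 subrr.
- by rewrite comp1m compm1.
- by rewrite compm1.
- by rewrite h0 comp0l comp0r.
Qed.

Lemma shift_lift X : exists X' : T, isomorphic (shift X') X.
Proof. by have [X' [t it]] := equiv_esurj (tr_shift ax) X; exists X', t. Qed.

Lemma shift_reflect X Y : isomorphic (shift X) (shift Y) -> isomorphic X Y.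
Proof.
case=> f /is_iso_sym[g [_ gf fg]].
have [a ea] := sh_full f; have [b eb] := sh_full g; subst f g.
by exists a, b; split; apply: sh_faithful; rewrite fmapM ?gf ?fg fmap1.
Qed.

Lemma isomorphic_shift X Y : isomorphic X Y -> isomorphic (shift X) (shift Y).
Proof. by case=> f fi; exists (sh f); exact: fmap_iso. Qed.

Lemma dist_fiber X Y Z (f : hom X Y) (g : hom Y Z) h : dist f g h ->
  exists (W : T) (k : hom W X) l, dist k f l /\ isomorphic (shift W) Z.
Proof.
move=> d; have [W [k [l d']]] := dist_invrot f.
by exists W, k, l; split=> //; exact: cone_unique (dist_rot d') d.
Qed.

(** Triangles can be desuspended although the shift is only an
    autoequivalence: the first map is, up to isomorphism, the shift of some f',
    and the shifted cone of f' is unique. *)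
Lemma dist_desuspend X Y Z (f : hom X (shift Y)) (g : hom (shift Y) Z) h :
  dist f g h -> exists (X' Z' : T) (f' : hom X' Y) (g' : hom Y Z') h',
    [/\ dist f' g' h', isomorphic (shift X') X & isomorphic (shift Z') Z].
Proof.
move=> d; have [X' [t it]] := shift_lift X.
have [t' [it' t't tt']] := is_iso_sym it.
have [f' ef] := sh_full (f ∘ t); have [Z' [g' [h' d']]] := tr_cone ax f'.
exists X', Z', f', g', h'; split=> //; first by exists t.
apply: cone_unique (dist_shift d') _; rewrite -ef.
apply: (tr_iso ax it' (is_iso1 _) (is_iso1 _) (h' := sh t' ∘ h) _ _ _ d).
- by rewrite comp1m -compA tt' compm1.
- by rewrite comp1m compm1.
- by rewrite compm1.
Qed.

Lemma dist_zero_r X Z : is_zero_ob Z -> dist (idm X) (0 : hom X Z) 0.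
Proof. exact: tr_id. Qed.

Lemma dist_zero_l X Z : is_zero_ob Z -> dist (0 : hom Z X) (idm X) 0.
Proof.
move=> Z0; apply/(tr_rot ax); rewrite fmap0 oppr0; apply: (tr_id ax).
exact: fmap_zero.
Qed.

End Triangles.

(** * Classes of extensions *)

Section Star.
Variable T : triangulated.
Implicit Types (X Y Z : T) (A B C D : T -> Prop).
Let ax := taxioms T.

Definition star A B Y := exists (X Z : T) (f : hom X Y) (g : hom Y Z) h,
  [/\ dist f g h, A X & B Z].

Definition star_closed A := forall X, star A A X -> A X.

Definition shift_orthogonal A B :=
  forall X Y, A X -> B Y -> forall f : hom X (shift Y), f = 0.

Definition has_zero A := forall X, is_zero_ob X -> A X.

Lemma star_mono A B A' B' X : (forall Y, A Y -> A' Y) -> (forall Y, B Y -> B' Y) ->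
  star A B X -> star A' B' X.
Proof.
move=> sA sB [Y [Z [f [g [h [d /sA AY /sB BZ]]]]]].
by exists Y, Z, f, g, h.
Qed.

Lemma star_iso A B : iso_closed (star A B).
Proof.
move=> X Y [t it] [X0 [Z [f [g [h [d AX BZ]]]]]].
have [t' [it' t't tt']] := is_iso_sym it.
exists X0, Z, (t ∘ f), (g ∘ t'), h; split=> //.
apply: (tr_iso ax (is_iso1 _) it (is_iso1 _) _ _ _ d).
- by rewrite compm1.
- by rewrite comp1m -compA t't compm1.
- by rewrite fmap1 comp1m compm1.
Qed.

Lemma star_self_l A B X : has_zero B -> A X -> star A B X.
Proof.
have [O O0] := tr_zero ax; move=> B0 AX.
by exists X, O, (idm X), 0, 0; split; [exact: dist_zero_r|done|exact: B0].
Qed.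

Lemma star_self_r A B X : has_zero A -> B X -> star A B X.
Proof.
have [O O0] := tr_zero ax; move=> A0 BX.
by exists O, X, 0, (idm X), 0; split; [exact: dist_zero_l|exact: A0|done].
Qed.

Lemma star_zero A B : has_zero A -> has_zero B -> has_zero (star A B).
Proof. by move=> A0 B0 X X0; apply: star_self_l => //; exact: A0. Qed.

(** Isomorphism-closed classes A and B are needed because a desuspension is
    determined only up to isomorphism. *)
Lemma star_unshift A B X : iso_closed A -> iso_closed B -> star A B (shift X) ->
  star (fun Y => A (shift Y)) (fun Y => B (shift Y)) X.
Proof.
move=> iA iB [Y [Z [f [g [h [d AY BZ]]]]]].
have [Y' [Z' [f' [g' [h' [d' iY iZ]]]]]] := dist_desuspend d.
exists Y', Z', f', g', h'; split=> //.
  exact: iA (isomorphic_sym iY) AY.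
exact: iB (isomorphic_sym iZ) BZ.
Qed.

Lemma star_shift A B X :
  star (fun Y => A (shift Y)) (fun Y => B (shift Y)) X -> star A B (shift X).
Proof.
move=> [Y [Z [f [g [h [d AY BZ]]]]]].
exists (shift Y), (shift Z), (sh f), (sh g), (- sh h).
by split; first exact: dist_shift.
Qed.

Lemma star_assocl A B C X : star (star A B) C X -> star A (star B C) X.
Proof.
move=> [F [Z [i [p [r [d [Y [E [f [g [h [d' AY BE]]]]]] CZ]]]]]].
have [W [k [l d2]]] := tr_cone ax (i ∘ f).
have [a [b [d3 _ _ _ _]]] := tr_oct ax d' d d2.
exists Y, W, (i ∘ f), k, l; split=> //.
by exists E, Z, a, b, (sh g ∘ r).
Qed.

(** The octahedral axiom applied to X -> E -> Z gives the triangle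
    Y[1] -> W[1] -> F[1], where W is the fiber of the composite; this triangle
    is then desuspended. *)
Lemma star_assocr A B C X : iso_closed A -> iso_closed B ->
  star A (star B C) X -> star (star A B) C X.
Proof.
move=> iA iB [Y [E [f [g [h [d AY [F [Z [i [p [r [d' BF CZ]]]]]]]]]]]].
have [W [k [l d2]]] := dist_invrot (p ∘ g).
have [a [b [d3 _ _ _ _]]] :=
  tr_oct ax (dist_rot d) (dist_rot d') (dist_rot d2).
exists W, Z, k, (p ∘ g), l; split=> //.
(* The endpoints are known only up to isomorphism after desuspension, so the
   classes used here are those of the objects isomorphic to Y[1] and F[1]. *)
have [|||Y' [Z' [f' [g' [h' [d4 AY' BZ']]]]]] := @star_unshift
  (fun V => isomorphic (shift Y) V) (fun V => isomorphic (shift F) V) W.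
- by move=> U V UV YU; exact: isomorphic_trans YU UV.
- by move=> U V UV YU; exact: isomorphic_trans YU UV.
- exists (shift Y), (shift F), a, b, (sh h ∘ (- sh i)); split=> //.
  + by exists (idm _); exact: is_iso1.
  + by exists (idm _); exact: is_iso1.
exists Y', Z', f', g', h'; split=> //.
  exact: iA (shift_reflect AY') AY.
exact: iB (shift_reflect BZ') BF.
Qed.

(** The connecting map of an extension of A by B vanishes, so the extension is
    a direct sum and can be read in the opposite order. *)
Lemma star_swap A B X : shift_orthogonal A B -> star B A X -> star A B X.
Proof.
move=> ort [Y [Z [f [g [h [d BY AZ]]]]]].
have h0 := ort _ _ AZ BY h; rewrite h0 in d.
have [s [r [rf gs rs gf e]]] := dist_split d.
exists Z, Y, s, r, 0; split=> //.
by apply: (biprod_dist (j := f) (p := g)); split=> //; rewrite addrC.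
Qed.

(** Sorting: in an extension built from layers A, B, A, B, the two inner layers
    can be exchanged by [star_swap]. *)
Lemma star_star A B X : iso_closed A -> iso_closed B -> shift_orthogonal A B ->
  star (star A B) (star A B) X -> star (star A A) (star B B) X.
Proof.
move=> iA iB ort /star_assocl s; apply: star_assocr => //.
apply: star_mono s => // Y /(star_assocr iB iA) s.
have {}s : star (star A B) B Y by apply: star_mono s => // Z; exact: star_swap.
exact: star_assocl.
Qed.

Lemma star_star_closed A B : iso_closed A -> iso_closed B ->
  shift_orthogonal A B -> star_closed A -> star_closed B ->
  star_closed (star A B).
Proof.
by move=> iA iB ort cA cB X /(star_star iA iB ort); exact: star_mono.
Qed.

(** The cone of X -> Y is an extension of X[1] by Y. *)
Lemma is_trisub_ext A : has_zero A -> iso_closed A -> star_closed A ->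
  (forall X, A X <-> A (shift X)) -> is_trisub A.
Proof.
move=> A0 iA cA sA; split=> // [X Y f fi|X Y Z f g h d AX AY].
  by apply: iA; exists f.
apply: (cA Z); exists Y, (shift X), g, h, (- sh f); split=> //.
  exact: dist_rot.
by have [+ _] := sA X; apply.
Qed.

End Star.

(** * Orthogonals and the additive closure *)

Section Classes.
Variables (T : triangulated) (w : T -> Prop).
Hypothesis ss : semi_selforthogonal w.
Implicit Types (X Y Z : T) (A B C : T -> Prop).
Let ax := taxioms T.

Lemma sh_eq0 X Y (f : hom X Y) : sh f = 0 -> f = 0.
Proof. by move=> f0; apply: sh_faithful; rewrite f0 fmap0. Qed.

Lemma hom0_iso X Y X' Y' : isomorphic X X' -> isomorphic Y Y' ->
  (forall f : hom X Y, f = 0) -> forall f : hom X' Y', f = 0.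
Proof.
move=> [a [a' [_ aa']]] [b [b' [_ bb']]] h f.
by rewrite -[f]comp1m -bb' -[f in _ ∘ f]compm1 -aa' -compA [f ∘ _]compA
  [b' ∘ _]compA (h (b' ∘ (f ∘ a))) comp0l comp0r.
Qed.

Lemma isomorphic_iter n X Y : isomorphic X Y ->
  isomorphic (iter n shift X) (iter n shift Y).
Proof. by move=> i; elim: n => //= n; exact: isomorphic_shift. Qed.

Lemma lperp_iso : iso_closed (lperp w).
Proof.
move=> X Y i lX M wM n n0; apply: (hom0_iso i _ (lX M wM n n0)).
by exists (idm _); exact: is_iso1.
Qed.

Lemma rperp_iso : iso_closed (rperp w).
Proof.
move=> X Y i rX M wM n n0; apply: (hom0_iso _ (isomorphic_iter n i) (rX M wM n n0)).
by exists (idm _); exact: is_iso1.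
Qed.

Lemma lperp_star : star_closed (lperp w).
Proof.
move=> Y [X [Z [f [g [h [d lX lZ]]]]]] M wM n n0 a.
have [|b ->] := dist_wcoker (a := a) d; first exact: lX wM n n0 _.
by rewrite (lZ M wM n n0 b) comp0l.
Qed.

Lemma rperp_star : star_closed (rperp w).
Proof.
move=> Y [X [Z [f [g [h [d rX rZ]]]]]] M wM n n0 a.
have [f' [g' [h' d']]] := dist_iter n d.
have [|b ->] := dist_wker (a := a) d'; first exact: rZ wM n n0 _.
by rewrite (rX M wM n n0 b) comp0r.
Qed.

Lemma lperp_unshift X : lperp w (shift X) -> lperp w X.
Proof. by move=> lX M wM n n0 f; apply: sh_eq0; exact: lX wM n.+1 _ _. Qed.

Lemma rperp_shift X : rperp w X -> rperp w (shift X).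
Proof. by move=> rX M wM n n0; rewrite -iterSr; exact: rX wM n.+1 _. Qed.

(** Vanishing passes from ω to add ω by writing the identity of a summand of a
    finite sum through the objects of ω. *)
Lemma rperp_from_add D Y (f : hom D (shift Y)) : rperp w Y -> add w D -> f = 0.
Proof.
move=> rY [I [M [P [wM [s [t [_ _ st]]] /summand_retract[a [b ba]]]]]].
rewrite -(compm1 f) -ba -(comp1m a) -st !(comp_suml, comp_sumr) big1 // => k _.
by rewrite !compA (rY _ (wM k) 1%N isT (f ∘ b ∘ s k)) !comp0l.
Qed.

Lemma lperp_to_add X D (f : hom X (shift D)) : lperp w X -> add w D -> f = 0.
Proof. by move=> lX aD; apply: (@lperp_add T w _ _ 1%N f lX aD). Qed.

Lemma add_iso : iso_closed (add w).
Proof.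
move=> X Y [f [f' [f'f ff']]] [I [M [P [wM sM [Q /biprodP]]]]].
case=> i [j [p [q [pi qj pj qi e]]]]; exists I, M, P; split=> //.
exists Q; apply/biprodP; exists (i ∘ f'), j, (f ∘ p), q; split=> //.
- by rewrite -compA [p ∘ _]compA pi comp1m.
- by rewrite -compA pj comp0r.
- by rewrite compA qi comp0l.
- by rewrite -compA [f' ∘ _]compA f'f comp1m.
Qed.

Lemma add_has_zero : has_zero (add w).
Proof. by move=> X; exact: add_zero. Qed.

(** Extensions between objects of add ω split, by the vanishing of maps from
    add ω to its shift. *)
Lemma add_star : star_closed (add w).
Proof.
move=> Y [X [Z [f [g [h [d aX aZ]]]]]].
have h0 := rperp_from_add h (rperp_add ss aX) aZ; rewrite h0 in d.
have [s [r [rf gs rs gf e]]] := dist_split d.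
by apply: add_biprod aX aZ; apply/biprodP; exists f, s, r, g.
Qed.

Lemma add_lperp X : add w X -> lperp w X.
Proof.
move=> [I [M [P [wM [s [t [_ _ st]]] /summand_retract[a [b ba]]]]]] N wN n n0 f.
rewrite -(compm1 f) -ba -(comp1m a) -st !(comp_suml, comp_sumr) big1 // => k _.
by rewrite !compA (ss (wM k) wN n0 (f ∘ b ∘ s k)) !comp0l.
Qed.

(** * The Auslander and co-Auslander classes *)

Lemma auslander_lperp X : auslander w X -> lperp w X.
Proof. by case=> S [M [<- /(_ 0%N)[]]]. Qed.

Lemma coauslander_rperp X : coauslander w X -> rperp w X.
Proof. by case=> S [M [<- /(_ 0%N)[]]]. Qed.

Lemma auslander_out X : auslander w X -> exists (M Y : T) (f : hom X M) (g : hom M Y) h,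
  [/\ dist f g h, add w M & auslander w Y].
Proof.
case=> S [M [S0 H]]; have [aM _ [f [g [h d]]]] := H 0%N.
move: f h d; rewrite S0 => f h d; exists (M 0%N), (S 1%N), f, g, h; split=> //.
by exists (fun n => S n.+1), (fun n => M n.+1).
Qed.

Lemma coauslander_out X : coauslander w X ->
  exists (M Y : T) (f : hom Y M) (g : hom M X) h,
  [/\ dist f g h, add w M & coauslander w Y].
Proof.
case=> S [M [S0 H]]; have [aM _ [f [g [h d]]]] := H 0%N.
move: g h d; rewrite S0 => g h d; exists (M 0%N), (S 1%N), f, g, h; split=> //.
by exists (fun n => S n.+1), (fun n => M n.+1).
Qed.

(** The Auslander class is the largest class in the left orthogonal each of
    whose objects starts a triangle X -> M -> Y with M in add ω and Y again in
    the class. This replaces the choice of whole sequences by a one-step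
    condition; the sequence is recovered by iterated choice. *)
Lemma auslander_coind C : (forall X, C X -> lperp w X) ->
  (forall X, C X -> exists (M Y : T) (f : hom X M) (g : hom M Y) h,
     [/\ dist f g h, add w M & C Y]) ->
  forall X, C X -> auslander w X.
Proof.
move=> Cl step X CX.
have H (U : {X | C X}) : exists MY : T * {X | C X}, add w MY.1 /\
    exists (f : hom (sval U) MY.1) (g : hom MY.1 (sval MY.2)) h, dist f g h.
  case: U => U CU; have [M [Y [f [g [h [d aM CY]]]]]] := step U CU.
  by exists (M, exist _ Y CY); split=> //; exists f, g, h.
pose next U := sval (cid (H U)).
pose S n := iter n (fun U => (next U).2) (exist _ X CX).
exists (fun n => sval (S n)), (fun n => (next (S n)).1); split=> // n.
have [aM tri] := svalP (cid (H (S n))).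
by split=> //; exact/Cl/(svalP (S n)).
Qed.

Lemma coauslander_coind C : (forall X, C X -> rperp w X) ->
  (forall X, C X -> exists (M Y : T) (f : hom Y M) (g : hom M X) h,
     [/\ dist f g h, add w M & C Y]) ->
  forall X, C X -> coauslander w X.
Proof.
move=> Cr step X CX.
have H (U : {X | C X}) : exists MY : T * {X | C X}, add w MY.1 /\
    exists (f : hom (sval MY.2) MY.1) (g : hom MY.1 (sval U)) h, dist f g h.
  case: U => U CU; have [M [Y [f [g [h [d aM CY]]]]]] := step U CU.
  by exists (M, exist _ Y CY); split=> //; exists f, g, h.
pose next U := sval (cid (H U)).
pose S n := iter n (fun U => (next U).2) (exist _ X CX).
exists (fun n => sval (S n)), (fun n => (next (S n)).1); split=> // n.
have [aM tri] := svalP (cid (H (S n))).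
by split=> //; exact/Cr/(svalP (S n)).
Qed.

Lemma auslander_iso : iso_closed (auslander w).
Proof.
move=> X Y i aX.
pose C Z := exists2 U, isomorphic U Z & auslander w U.
apply: (@auslander_coind C); last by exists X.
  by move=> Z [U iU /auslander_lperp]; exact: lperp_iso.
move=> Z [U [t it] /auslander_out[M [V [f [g [h [d aM aV]]]]]]].
have [t' [it' t't tt']] := is_iso_sym it.
exists M, V, (f ∘ t'), g, (sh t ∘ h); split=> //; last first.
  by exists V => //; exists (idm V); exact: is_iso1.
apply: (tr_iso ax it (is_iso1 _) (is_iso1 _) _ _ _ d).
- by rewrite comp1m -compA t't compm1.
- by rewrite comp1m compm1.
- by rewrite compm1.
Qed.

Lemma coauslander_iso : iso_closed (coauslander w).
Proof.
move=> X Y i aX.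
pose C Z := exists2 U, isomorphic U Z & coauslander w U.
apply: (@coauslander_coind C); last by exists X.
  by move=> Z [U iU /coauslander_rperp]; exact: rperp_iso.
move=> Z [U [t it] /coauslander_out[M [V [f [g [h [d aM aV]]]]]]].
have [t' [it' t't tt']] := is_iso_sym it.
exists M, V, f, (t ∘ g), (h ∘ t'); split=> //; last first.
  by exists V => //; exists (idm V); exact: is_iso1.
apply: (tr_iso ax (is_iso1 _) (is_iso1 _) it _ _ _ d).
- by rewrite comp1m compm1.
- by rewrite compm1.
- by rewrite fmap1 comp1m -compA t't compm1.
Qed.

(** Rotated, the coresolution step X -> M -> X' reads X'[-1] -> X -> M, so that
    X is an extension of M by X'[-1]; sorting applies to this form. *)
Lemma auslander_in_star X : auslander w X ->
  star (fun Y => auslander w (shift Y)) (add w) X.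
Proof.
move=> /auslander_out[M [Y [f [g [h [d aM aY]]]]]].
have [W [k [l [d' i]]]] := dist_fiber d.
exists W, M, k, f, l; split=> //.
exact: auslander_iso (isomorphic_sym i) aY.
Qed.

Lemma auslander_star_coind C : (forall X, C X -> lperp w X) ->
  (forall X, C X -> star (fun Y => C (shift Y)) (add w) X) ->
  forall X, C X -> auslander w X.
Proof.
move=> Cl step; apply: auslander_coind => // X /step.
move=> [Y [M [f [g [h [d CY aM]]]]]].
by exists M, (shift Y), g, h, (- sh f); split=> //; exact: dist_rot.
Qed.

(** The closure under isomorphism is what makes this class usable as a factor
    of [star_star]. *)
Definition suspension A Y := exists2 Z, A Z & isomorphic (shift Z) Y.

Lemma suspension_iso A : iso_closed (suspension A).
Proof. by move=> X Y i [Z AZ iZ]; exists Z => //; exact: isomorphic_trans iZ i. Qed.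

Lemma suspensionK A X : iso_closed A -> suspension A (shift X) -> A X.
Proof. by move=> iA [Z AZ /shift_reflect i]; exact: iA i AZ. Qed.

Lemma coauslander_in_star X : coauslander w X ->
  star (add w) (suspension (coauslander w)) X.
Proof.
move=> /coauslander_out[M [Y [f [g [h [d aM aY]]]]]].
exists M, (shift Y), g, h, (- sh f); split=> //; first exact: dist_rot.
by exists Y => //; exists (idm _); exact: is_iso1.
Qed.

Lemma coauslander_star_coind C : (forall X, C X -> rperp w X) -> iso_closed C ->
  (forall X, C X -> star (add w) (suspension C) X) ->
  forall X, C X -> coauslander w X.
Proof.
move=> Cr iC step; apply: coauslander_coind => // X /step.
move=> [M [Y [f [g [h [d aM [Z CZ iZ]]]]]]].
have [W [k [l [d' i]]]] := dist_fiber d.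
exists M, W, k, f, l; split=> //.
apply: iC CZ; apply: shift_reflect; apply: isomorphic_trans iZ _.
exact: isomorphic_sym.
Qed.

Lemma add_auslander X : add w X -> auslander w X.
Proof.
apply: auslander_coind => [{}X|{}X aX]; first exact: add_lperp.
have [O O0] := tr_zero ax.
by exists X, O, (idm X), 0, 0; split=> //; [exact: dist_zero_r|exact: add_zero].
Qed.

Lemma auslander_zero : has_zero (auslander w).
Proof. by move=> X X0; exact/add_auslander/add_zero. Qed.

Lemma add_coauslander X : add w X -> coauslander w X.
Proof.
apply: coauslander_coind => [{}X|{}X aX]; first exact: rperp_add.
have [O O0] := tr_zero ax.
by exists X, O, 0, (idm X), 0; split=> //; [exact: dist_zero_l|exact: add_zero].
Qed.

Lemma coauslander_zero : has_zero (coauslander w).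
Proof. by move=> X X0; exact/add_coauslander/add_zero. Qed.

(** If X[1] is in the class, X starts the triangle X -> 0 -> X[1]. *)
Lemma auslander_unshift X : auslander w (shift X) -> auslander w X.
Proof.
move=> aX; apply: (@auslander_coind (fun X => auslander w X \/ auslander w (shift X))).
- by move=> Z [|] /auslander_lperp //; exact: lperp_unshift.
- move=> Z [/auslander_out[M [Y [f [g [h [d aM aY]]]]]]|aZ].
    by exists M, Y, f, g, h; split=> //; left.
  have [O O0] := tr_zero ax; exists O, (shift Z), 0, 0, (- sh (idm Z)).
  split; [exact/dist_rot/dist_zero_r|exact: add_zero|by left].
- by right.
Qed.

(** If X is in the class, X[1] ends the triangle X -> 0 -> X[1]. *)
Lemma coauslander_shift X : coauslander w X -> coauslander w (shift X).
Proof.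
move=> aX; apply: (@coauslander_coind (fun Y => coauslander w Y \/
  exists2 X, Y = shift X & coauslander w X)).
- by move=> Z [|[U ->]] /coauslander_rperp //; exact: rperp_shift.
- move=> Z [/coauslander_out[M [Y [f [g [h [d aM aY]]]]]]|[U -> aU]].
    by exists M, Y, f, g, h; split=> //; left.
  have [O O0] := tr_zero ax; exists O, U, 0, 0, (- sh (idm U)).
  split; [exact/dist_rot/dist_zero_r|exact: add_zero|by left].
- by right; exists X.
Qed.

(** A horseshoe lemma. Extensions of Auslander objects form a coinductive
    class: by sorting, each of them is an extension of an object of add ω by
    some E such that E[1] is again an extension of Auslander objects. *)
Lemma auslander_star : star_closed (auslander w).
Proof.
apply: auslander_star_coind => X sX.
  by apply: lperp_star; apply: star_mono sX; exact: auslander_lperp.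
have {}sX := star_mono (@auslander_in_star) (@auslander_in_star) sX.
have ort : shift_orthogonal (fun Y => auslander w (shift Y)) (add w).
  move=> Y D /auslander_lperp/lperp_unshift lY aD f; exact: lperp_to_add lY aD.
have iA : iso_closed (fun Y => auslander w (shift Y)).
  by move=> Y Z /isomorphic_shift; exact: auslander_iso.
apply: star_mono (star_star iA add_iso ort sX); last exact: add_star.
by move=> Y; exact: star_shift.
Qed.

Lemma coauslander_star : star_closed (coauslander w).
Proof.
apply: coauslander_star_coind => [X sX||X sX].
- by apply: rperp_star; apply: star_mono sX; exact: coauslander_rperp.
- exact: star_iso.
have {}sX := star_mono (@coauslander_in_star) (@coauslander_in_star) sX.
have ort : shift_orthogonal (add w) (suspension (coauslander w)).
  move=> D Y aD [Z /coauslander_rperp/rperp_shift rZ iZ] f.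
  exact: rperp_from_add (rperp_iso iZ rZ) aD.
apply: star_mono (star_star add_iso (@suspension_iso _) ort sX); first exact: add_star.
move=> Y sY; have [Y' i] := shift_lift Y.
exists Y' => //; have := star_iso (isomorphic_sym i) sY.
move=> /(star_unshift (@suspension_iso _) (@suspension_iso _)).
by apply: star_mono => Z; exact: (suspensionK coauslander_iso).
Qed.

(** * Negative and positive shifts of add ω *)

(** The extension closure of the D[i] with D in add ω and i < 0. Negative
    shifts are expressed by conditions on the shifts of an object, since the
    shift functor has no chosen inverse. *)
Inductive lower : T -> Prop :=
  | lower_add X : add w (shift X) -> lower X
  | lower_unshift X : lower (shift X) -> lower X
  | lower_ext X Y Z (f : hom X Y) (g : hom Y Z) h :
      dist f g h -> lower X -> lower Z -> lower Y.

(** The extension closure of the D[i] with D in add ω and i > 0. *)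
Inductive upper : T -> Prop :=
  | upper_add X : add w X -> upper (shift X)
  | upper_shift X : upper X -> upper (shift X)
  | upper_ext X Y Z (f : hom X Y) (g : hom Y Z) h :
      dist f g h -> upper X -> upper Z -> upper Y.

Lemma lower_star : star_closed lower.
Proof. by move=> Y [X [Z [f [g [h [d lX lZ]]]]]]; exact: lower_ext d lX lZ. Qed.

Lemma upper_star : star_closed upper.
Proof. by move=> Y [X [Z [f [g [h [d lX lZ]]]]]]; exact: upper_ext d lX lZ. Qed.

Lemma lower_zero : has_zero lower.
Proof. by move=> X X0; apply/lower_add/add_zero/fmap_zero. Qed.

Lemma lower_iso : iso_closed lower.
Proof.
move=> X Y i lX; apply: lower_star; apply: (star_iso i).
exact: star_self_l lower_zero lX.
Qed.

(** The zero object used for the trivial extension is the shift of one,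
    because [upper_add] only yields shifted objects. *)
Lemma upper_iso : iso_closed upper.
Proof.
move=> X Y i uX; apply: upper_star; apply: (star_iso i).
have [O O0] := tr_zero ax; exists X, (shift O), (idm X), 0, 0; split=> //.
  by apply: dist_zero_r; exact: fmap_zero.
exact/upper_add/add_zero.
Qed.

Lemma upper_zero : has_zero upper.
Proof.
move=> X X0; have [Y [t it]] := shift_lift X.
apply: (upper_iso (X := shift Y)); first by exists t.
apply/upper_add/add_zero/sh_faithful.
by case: it => u [ut _]; rewrite fmap1 -ut (to_zero t X0) comp0r fmap0.
Qed.

Lemma lower_sub (N : trisub T) X :
  (forall Y, add w Y -> N Y) -> lower X -> N X.
Proof.
move=> aN; elim=> {X} [X /aN|X _|X Y Z f g h d _ NX _ NZ].
- by case: (ts_shift (ts_axioms N) X) => _; apply.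
- by case: (ts_shift (ts_axioms N) X) => _; apply.
- exact: ts_ext d NX NZ.
Qed.

Lemma upper_sub (N : trisub T) X :
  (forall Y, add w Y -> N Y) -> upper X -> N X.
Proof.
move=> aN; elim=> {X} [X /aN|X _|X Y Z f g h d _ NX _ NZ].
- by case: (ts_shift (ts_axioms N) X) => + _; apply.
- by case: (ts_shift (ts_axioms N) X) => + _; apply.
- exact: ts_ext d NX NZ.
Qed.

Lemma lower_rperp X Y (a : hom X Y) : lower X -> rperp w Y -> a = 0.
Proof.
move=> lX; elim: lX Y a => {X} [X aX|X _ IH|X Y Z f g h d _ IHX _ IHZ] V a rV.
- exact/sh_eq0/rperp_from_add.
- exact/sh_eq0/IH/rperp_shift.
- have [|b ->] := dist_wcoker (a := a) d; first exact: IHX.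
  by rewrite (IHZ _ b rV) comp0l.
Qed.

Lemma upper_lperp X Y (a : hom X Y) : upper Y -> lperp w X -> a = 0.
Proof.
move=> uY; elim: uY X a => {Y} [Y aY|Y _ IH|X Y Z f g h d _ IHX _ IHZ] V a lV.
- exact: lperp_to_add lV aY.
- have [V' i] := shift_lift V.
  have lV' : lperp w V' by apply/lperp_unshift/(lperp_iso (isomorphic_sym i)).
  apply: (hom0_iso i (ex_intro _ _ (is_iso1 _))) => b.
  by have [c ->] := sh_full b; rewrite (IH _ c lV') fmap0.
- have [|b ->] := dist_wker (a := a) d; first exact: IHZ.
  by rewrite (IHX _ b lV) comp0r.
Qed.

Lemma upper_in_rperp X : upper X -> rperp w X.
Proof.
move=> uX M wM n _ f; apply: upper_lperp => [|N wN i i0 g]; last exact: ss.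
by elim: n {f} => // n; exact: upper_shift.
Qed.

Lemma lower_add_orthogonal : shift_orthogonal lower (add w).
Proof. by move=> X Y lX aY f; apply/lower_rperp/rperp_shift/rperp_add. Qed.

Lemma add_upper_orthogonal : shift_orthogonal (add w) upper.
Proof. by move=> X Y aX uY f; apply: upper_lperp (upper_shift uY) (add_lperp aX). Qed.

Lemma add_upper_star : star_closed (star (add w) upper).
Proof.
exact: star_star_closed add_iso upper_iso add_upper_orthogonal add_star upper_star.
Qed.

(** The layers of X[1] are of the form D[i] with i <= 0, and those with i = 0
    can be sorted to the end. *)
Lemma lower_suspend X : lower X -> star lower (add w) (shift X).
Proof.
elim=> {X} [X aX|X lX _|X Y Z f g h d _ IHX _ IHZ].
- exact: star_self_r lower_zero aX.
- exact: star_self_l add_has_zero lX.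
- apply: (star_star_closed lower_iso add_iso lower_add_orthogonal
    lower_star add_star).
  exists (shift X), (shift Z), (sh f), (sh g), (- sh h).
  by split; first exact: dist_shift.
Qed.

(** Dual to [lower_suspend]. Since an extension only presents X[1] up to
    isomorphism, the induction runs over all desuspensions of its parts. *)
Lemma upper_desuspend X : upper (shift X) -> star (add w) upper X.
Proof.
pose P Z := forall Y, isomorphic (shift Y) Z -> star (add w) upper Y.
have iP : iso_closed P.
  by move=> U V i PU Y iY; apply: PU; exact: isomorphic_trans iY (isomorphic_sym i).
suff uP Z : upper Z -> P Z by move=> /uP; apply; exists (idm _); exact: is_iso1.
elim=> {Z} [Z aZ|Z uZ _|U Y V f g h d _ PU _ PV] X' /=.
- move=> /shift_reflect/isomorphic_sym i.
  by apply: (star_iso i); exact: star_self_l upper_zero aZ.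
- move=> /shift_reflect/isomorphic_sym i.
  by apply: (star_iso i); apply: star_self_r uZ; exact: add_has_zero.
- move=> i; apply: add_upper_star.
  have sY : star P P Y by exists U, V, f, g, h.
  have := star_unshift iP iP (star_iso (isomorphic_sym i) sY).
  by apply: star_mono => S; apply; exists (idm _); exact: is_iso1.
Qed.

(** * Decompositions of triangulated spans *)

(** The existence of weight decompositions in the span of a presilting
    subcategory: objects can be sorted by the degrees of their layers. *)
Lemma span_add_star X : trispan (add w) X -> star (star lower (add w)) upper X.
Proof.
pose E := star (add w) upper.
have E0 : has_zero E by exact: star_zero add_has_zero upper_zero.
have iE : iso_closed E by exact: star_iso.
have ort : shift_orthogonal lower E.
  move=> U V lU EV f; apply: lower_rperp lU _; apply: rperp_shift.
  apply: rperp_star; apply: star_mono EV; last exact: upper_in_rperp.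
  by move=> D; exact: rperp_add.
have tW : is_trisub (star lower E).
  apply: is_trisub_ext; first exact: star_zero lower_zero E0.
  - exact: star_iso.
  - exact: star_star_closed lower_iso iE ort lower_star add_upper_star.
  - move=> Y; split=> sY.
      apply: star_assocl; apply: star_shift; apply: star_mono sY => Z.
        exact: lower_suspend.
      rewrite /E => EZ; apply: upper_star; apply: star_shift.
      by apply: star_mono EZ => V; [exact: upper_add|exact: upper_shift].
    have {}sY := star_unshift lower_iso iE sY.
    have {}sY : star lower (star lower E) Y.
      apply: star_mono sY => Z; first exact: lower_unshift.
      move=> /(star_unshift add_iso upper_iso).
      by apply: star_mono => V; [exact: lower_add|exact: upper_desuspend].
    by apply: star_mono (star_assocr lower_iso lower_iso sY) => // Z; exact: lower_star.
move=> /(_ (Trisub tW)) H; apply: (star_assocr lower_iso add_iso).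
apply: H => Y aY /=; apply: star_self_r lower_zero _; exact: star_self_l upper_zero aY.
Qed.

(** Closure under the shift is the coresolution step A -> M -> A' in the form of
    an extension of M[1] by A', which presents A[1]. *)
Lemma span_auslander_star X :
  trispan (auslander w) X -> star (auslander w) upper X.
Proof.
have ort : shift_orthogonal (auslander w) upper.
  by move=> U V /auslander_lperp lU uV f; exact: upper_lperp (upper_shift uV) lU.
have tW : is_trisub (star (auslander w) upper).
  apply: is_trisub_ext.
  - exact: star_zero auslander_zero upper_zero.
  - exact: star_iso.
  - exact: star_star_closed auslander_iso upper_iso ort auslander_star upper_star.
  - move=> Y; split=> sY.
      have : star (star (auslander w) upper) upper (shift Y).
        apply: star_shift; apply: star_mono sY => Z; last exact: upper_shift.
        move=> /auslander_out[M [V [f [g [h [d aM aV]]]]]].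
        exists V, (shift M), h, (- sh f), (- sh g); split=> //.
          exact/dist_rot/dist_rot.
        exact: upper_add.
      by move=> /star_assocl; apply: star_mono => // Z; exact: upper_star.
    have : star (auslander w) (star (add w) upper) Y.
      apply: star_mono (star_unshift auslander_iso upper_iso sY) => Z.
        exact: auslander_unshift.
      exact: upper_desuspend.
    move=> /(star_assocr auslander_iso add_iso); apply: star_mono => // Z sZ.
    apply: auslander_star; apply: star_mono sZ => // V; exact: add_auslander.
by move=> /(_ (Trisub tW)); apply=> Y aY /=; exact: star_self_l upper_zero aY.
Qed.

(** Closure under desuspension is the resolution step B' -> M -> B in the form of
    an extension of B' by M[-1], which presents B[-1]. *)
Lemma span_coauslander_star X :
  trispan (coauslander w) X -> star lower (coauslander w) X.
Proof.
have ort : shift_orthogonal lower (coauslander w).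
  by move=> U V lU /coauslander_rperp/rperp_shift rV f; exact: lower_rperp lU rV.
have tW : is_trisub (star lower (coauslander w)).
  apply: is_trisub_ext.
  - exact: star_zero lower_zero coauslander_zero.
  - exact: star_iso.
  - exact: star_star_closed lower_iso coauslander_iso ort lower_star coauslander_star.
  - move=> Y; split=> sY.
      have : star (star lower (add w)) (coauslander w) (shift Y).
        apply: star_shift; apply: star_mono sY => Z; first exact: lower_suspend.
        exact: coauslander_shift.
      move=> /star_assocl; apply: star_mono => // Z sZ.
      apply: coauslander_star; apply: star_mono sZ => // V; exact: add_coauslander.
    have : star lower (star lower (coauslander w)) Y.
      apply: star_mono (star_unshift lower_iso coauslander_iso sY) => Z.
        exact: lower_unshift.
      move=> /coauslander_in_star/(star_unshift add_iso (@suspension_iso _)).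
      by apply: star_mono => V; [exact: lower_add|exact: (suspensionK coauslander_iso)].
    move=> /(star_assocr lower_iso lower_iso); apply: star_mono => // Z.
    exact: lower_star.
by move=> /(_ (Trisub tW)); apply=> Y aY /=; exact: star_self_r lower_zero aY.
Qed.

(** The class contains add ω and is closed under desuspension and extensions,
    and lower[1] is built from the D[i] with i <= 0. *)
Lemma lower_suspend_auslander X : lower X -> auslander w (shift X).
Proof.
elim=> {X} [X aX|X _ /auslander_unshift|X Y Z f g h d _ IHX _ IHZ].
- exact: add_auslander.
- by apply.
- apply: auslander_star.
  exists (shift X), (shift Z), (sh f), (sh g), (- sh h).
  by split; first exact: dist_shift.
Qed.

End Classes.

(** * Images of morphisms in a Verdier quotient *)

Section Localization.
Variables (T : triangulated) (N : trisub T).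
Implicit Types X Y Z : T.

Lemma loc_iso X Y (s : hom X Y) : qis N s -> is_iso (loc N s : hom (X : vcat N) Y).
Proof.
move=> q; have q1 : qis N (idm X ∘ idm X) by rewrite compm1; exact: qis1.
exists (frac q (idm X)); split.
  rewrite /= /loc (vcompE (qis1 N X) q (idm X) (t := idm X) (g := idm X) q1).
  - by symmetry; apply: (frac_ext _ (t := idm X)); rewrite compm1.
  - exact: qis1.
  - by [].
rewrite /= vcomp_loc compm1 /loc.
by symmetry; apply: (frac_ext _ (t := s)); rewrite comp1m.
Qed.

Lemma loc_zero Z : N Z -> loc N (idm Z) = 0 :> vhom N Z Z.
Proof.
move=> NZ; have [O O0] := tr_zero (taxioms T).
apply/(frac_eq (qis1 N Z) (idm Z) 0); exists O, 0; split; last by rewrite !comp0r.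
by exists Z, (idm Z), 0; split=> //; exact: dist_zero_l.
Qed.

(** A map is killed by the localization when it vanishes on some t with cone
    in N, and then it factors through that cone. *)
Lemma loc_eq0 X Y (f : hom X Y) : loc N f = 0 :> vhom N X Y ->
  exists (Z : T) (a : hom X Z) (b : hom Z Y), N Z /\ f = b ∘ a.
Proof.
move=> /(frac_eq (qis1 N X) f 0)[V [t [[Z [g [h [d NZ]]]] ft]]].
have [|b fb] := dist_wcoker (a := f) d; first by rewrite ft comp0l.
by exists Z, g, b.
Qed.

End Localization.

(** * Fully faithful and dense functors *)

(** The quasi-inverse sends Y to a chosen preimage and g to the unique map whose
    image is the conjugate of g by the chosen isomorphisms. *)
Lemma fully_faithful_equivalence (C D : preadditive) (F : functor C D) :
    (forall (X Y : C) (f : hom X Y), fmap F f = 0 -> f = 0) ->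
    (forall (X Y : C) (g : hom (F X) (F Y)), exists f, g = fmap F f) ->
    (forall Y : D, exists X : C, isomorphic (F X) Y) ->
  is_equivalence F.
Proof.
move=> ker0 full dense.
have inj X Y (f f' : hom X Y) : fmap F f = fmap F f' -> f = f'.
  move=> e; apply/eqP; rewrite -subr_eq0; apply/eqP/ker0.
  by rewrite fmapD fmapN e subrr.
have H (Y : D) : exists x : {X : C & (hom (F X) Y * hom Y (F X))%type},
    (projT2 x).2 ∘ (projT2 x).1 = idm _ /\ (projT2 x).1 ∘ (projT2 x).2 = idm Y.
  by have [X [f [g [gf fg]]]] := dense Y; exists (existT _ X (f, g)).
pose G0 Y : C := projT1 (sval (cid (H Y))).
pose e Y : hom (F (G0 Y)) Y := (projT2 (sval (cid (H Y)))).1.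
pose e' Y : hom Y (F (G0 Y)) := (projT2 (sval (cid (H Y)))).2.
have e'e Y : e' Y ∘ e Y = idm _ by case: (svalP (cid (H Y))).
have ee' Y : e Y ∘ e' Y = idm _ by case: (svalP (cid (H Y))).
pose Gm (Y Z : D) (g : hom Y Z) : hom (G0 Y) (G0 Z) :=
  sval (cid (full _ _ (e' Z ∘ g ∘ e Y))).
have FG Y Z (g : hom Y Z) : fmap F (Gm Y Z g) = e' Z ∘ g ∘ e Y.
  by rewrite /Gm; case: cid.
have G1 Y : Gm Y Y (idm Y) = idm (G0 Y).
  by apply: inj; rewrite FG compm1 e'e fmap1.
have GM X Y Z (g : hom Y Z) (f : hom X Y) : Gm _ _ (g ∘ f) = Gm _ _ g ∘ Gm _ _ f.
  by apply: inj; rewrite fmapM !FG -!compA [e Y ∘ _]compA ee' comp1m.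
have GD X Y (f f' : hom X Y) : Gm _ _ (f + f') = Gm _ _ f + Gm _ _ f'.
  by apply: inj; rewrite fmapD !FG compDr compDl.
exists (@Functor D C G0 Gm G1 GM GD); split; last first.
  exists e; split=> [Y Z g|Y]; last by exists (e' Y); rewrite e'e ee'.
  by rewrite /= FG !compA ee' comp1m.
pose u X := sval (cid (full _ _ (e (F X)))).
have Fu X : fmap F (u X) = e (F X) by rewrite /u; case: cid.
exists u; split=> [X Y f|X] /=.
  by apply: inj; rewrite !fmapM FG Fu Fu !compA ee' comp1m.
have [v ev] := full _ _ (e' (F X)).
by exists v; split; apply: inj; rewrite fmapM Fu -ev fmap1.
Qed.

(** * The stable category and the Verdier quotient *)

Section Equivalence.
Variables (T : triangulated) (w : T -> Prop).
Hypothesis ss : semi_selforthogonal w.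
Implicit Types X Y Z : T.
Local Notation K := (trispan (add w)).

Lemma add_span X : add w X -> K X.
Proof. by move=> aX N; apply. Qed.

(** G is an extension of V[1] by A where V is the lower part of A; this is what
    puts G in both classes at once. *)
Lemma gorenstein_approximation X :
    (forall Y, trispan (coauslander w) Y) -> (forall Y, trispan (auslander w) Y) ->
  exists (A G : T) (s : hom A X) (t : hom A G), [/\ qis K s, qis K t & gorenstein w G].
Proof.
move=> cB cA.
have [A [U [s [p [r [d aA uU]]]]]] := span_auslander_star ss (cA X).
have [V [G [i [t [q [d' lV bG]]]]]] := span_coauslander_star ss (cB A).
exists A, G, s, t; split.
- by exists U, p, r; split=> //; exact: upper_sub add_span uU.
- exists (shift V), q, (- sh i); split; first exact: dist_rot.
  by have [+ _] := ts_shift (ts_axioms K) V; apply; exact: lower_sub add_span lV.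
- split=> //; apply: (auslander_star ss).
  exists A, (shift V), t, q, (- sh i); split=> //; first exact: dist_rot.
  exact: lower_suspend_auslander.
Qed.

(** The component of the map in the upper part of Z vanishes. *)
Lemma span_lperp_factor X Z (a : hom X Z) : lperp w X -> K Z ->
  exists (Y : T) (b : hom X Y) (c : hom Y Z),
    star (lower w) (add w) Y /\ a = c ∘ b.
Proof.
move=> lX /(span_add_star ss)[Y [U [c [g [h [d sY uU]]]]]].
have [|b ->] := dist_wker (a := a) d; first exact: upper_lperp uU lX.
by exists Y, b, c.
Qed.

Lemma lower_add_span X : star (lower w) (add w) X -> K X.
Proof.
move=> [Y [Z [f [g [h [d lY aZ]]]]]].
exact: ts_ext d (lower_sub add_span lY) (add_span aZ).
Qed.

(** The denominator of a fraction can be refined so that its cone Z0 lies in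
    star lower D; then the numerator has no obstruction to extending along the
    denominator, as maps from Z0 to Y[1] vanish. *)
Lemma loc_full X Y (a : vhom K X Y) : lperp w X -> rperp w Y ->
  exists f, a = loc K f.
Proof.
move=> lX rY; have [W [s [q [f ->]]]] := frac_surj a.
have [Z [k [l [d KZ]]]] := q.
have [Z0 [k0 [i [sZ0 ek]]]] := span_lperp_factor k lX KZ.
(* t refines the denominator s: it is the fiber of the factor k0 of the map k
   from X to the cone of s. *)
have [V [t [m d']]] := dist_invrot k0.
have [|u eu] := dist_wker (a := t) d.
  by rewrite ek -compA (dist_comp0 d') comp0r.
have qt : qis K t by exists Z0, k0, m; split=> //; exact: lower_add_span.
have [|b eb] := dist_wcoker (a := sh (f ∘ u)) (dist_rot (dist_rot d')).
  have [L [D [x [y [z [d3 lL aD]]]]]] := sZ0.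
  have [|c ->] := dist_wcoker (a := sh (f ∘ u) ∘ m) d3.
    exact: lower_rperp lL (rperp_shift rY).
  by rewrite (rperp_from_add c rY aD) comp0l.
have [b' eb'] := sh_full b; subst b.
have {}eb : f ∘ u = (- b') ∘ t.
  by apply: sh_faithful; rewrite eb compNr -compNl -fmapN -fmapM.
exists (- b'); rewrite (frac_ext q qt eu erefl) eb; symmetry.
by apply: (frac_ext _ (t := t)); rewrite ?comp1m.
Qed.

(** The map factors through an object of star lower D; it vanishes on the lower
    part of that object and so factors through the part in add ω. *)
Lemma loc_faithful X Y (f : hom X Y) : lperp w X -> rperp w Y ->
  loc K f = 0 :> vhom K X Y -> f \in @factors T w X Y.
Proof.
move=> lX rY /loc_eq0[Z [a [b [KZ ->]]]].
have [Z0 [a0 [i [[L [D [x [y [z [d lL aD]]]]]] ->]]]] := span_lperp_factor a lX KZ.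
have [|c ec] := dist_wcoker (a := b ∘ i) d; first exact: lower_rperp lL rY.
by apply/factorsP; exists D, (y ∘ a0), c; rewrite !compA -ec.
Qed.

Lemma factors_loc X Y (f : hom X Y) : f \in @factors T w X Y ->
  loc K f = 0 :> vhom K X Y.
Proof.
move=> /factorsP[D [a [b [aD ->]]]].
rewrite -[b]compm1 -[LHS]/(fmap (vloc K) _) !fmapM.
by rewrite [fmap _ (idm D)](loc_zero (add_span aD)) comp0r comp0l.
Qed.

Variable c : shift_choice w.

(** Any representative may be used, by [sloc_mapE]. *)
Definition sloc_map (A B : scat w) (a : hom A B) : hom (sval A : vcat K) (sval B) :=
  loc K (repr a).

Lemma sloc_mapE (A B : gorenstein_ob w) (f : hom (sval A) (sval B)) :
  @sloc_map A B (spi f) = loc K f.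
Proof.
have /spiE/factors_loc : spi (repr (spi f)) = spi f by exact: reprK.
rewrite -[loc K _]/(fmap (vloc K) _) fmapD fmapN => /eqP.
by rewrite subr_eq0 => /eqP.
Qed.

Fact sloc1 (A : scat w) : sloc_map (idm A) = idm (sval A : vcat K).
Proof. exact: sloc_mapE. Qed.

Fact slocM (A B E : scat w) (g : hom B E) (f : hom A B) :
  sloc_map (g ∘ f) = sloc_map g ∘ sloc_map f.
Proof.
have [[g' ->] [f' ->]] := conj (spi_surj g) (spi_surj f).
by rewrite /= scompE !sloc_mapE locM.
Qed.

Fact slocD (A B : scat w) (f f' : hom A B) :
  sloc_map (f + f') = sloc_map f + sloc_map f'.
Proof.
have [[g ->] [g' ->]] := conj (spi_surj f) (spi_surj f').
by rewrite -spiD !sloc_mapE locD.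
Qed.

Definition sloc : functor (scat w) (vcat K) :=
  @Functor (scat w) (vcat K) sval sloc_map sloc1 slocM slocD.

(** The connecting map G<1> -> G[1] has cone D_G[1], so it is invertible in the
    quotient. *)
Definition sloc_shift (A : scat w) : hom (sloc (sshift c A)) (vshift K (sloc A)) :=
  loc K (sc_h c A).

Fact sloc_shift_nat : is_nat_iso (F := comp_functor sloc (sshift c))
  (G := comp_functor (vshift K) sloc) sloc_shift.
Proof.
split=> [A B a|A].
  have [f ->] := spi_surj a; have [g fg] := completes_ex c f.
  case: (fg) => x [_ _ e3].
  rewrite /= (sshiftE fg) !sloc_mapE.
  rewrite -locM -e3 locM; congr (vcomp _ _); rewrite /loc vshiftE.
  by symmetry; apply: (frac_ext _ (t := idm _)); rewrite ?fmap1 compm1.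
apply: loc_iso; exists (shift (sc_D c A)), (- sh (sc_f c A)), (- sh (sc_g c A)).
split; first exact/dist_rot/dist_rot/sc_dist.
by have [+ _] := ts_shift (ts_axioms K) (sc_D c A); apply; exact/add_span/sc_add.
Qed.

Fact sloc_dist (A B E : stable c) (f : hom A B) (g : hom B E) (h : hom E (shift A)) :
  dist f g h -> vdist (N := K) (fmap sloc f) (fmap sloc g) (sloc_shift A ∘ fmap sloc h).
Proof.
move=> [A' [B' [E' [f' [g' [h' [a [b [e [ind [ia [ib ie]] e1 e2 e3]]]]]]]]]].
case: ind => [f0 [g0 [h0 [y [z [d _ _ hz [ef eg eh]]]]]]]; subst f' g' h'.
exists (sval A'), (sval B'), (sval E'), f0, g0, h0,
  (fmap sloc a), (fmap sloc b), (fmap sloc e); split=> //.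
- split; first exact: (fmap_iso sloc ia).
  by split; [exact: (fmap_iso sloc ib)|exact: (fmap_iso sloc ie)].
- rewrite -[fmap _ f0](@sloc_mapE A' B').
  exact: etrans (esym (slocM _ _)) (etrans (congr1 (@sloc_map _ _) e1) (slocM _ _)).
- rewrite -[fmap _ g0](@sloc_mapE B' E').
  exact: etrans (esym (slocM _ _)) (etrans (congr1 (@sloc_map _ _) e2) (slocM _ _)).
- have {}e3 :=
    etrans (esym (slocM _ _)) (etrans (congr1 (@sloc_map _ _) e3) (slocM _ _)).
  rewrite -compA -[X in _ = _ ∘ X]e3 compA (sloc_shift_nat.1 _ _ a) -compA.
  by rewrite -hz /= sloc_mapE locM.
Qed.

Definition sloc_triangle : triangle_functor (stable c) (relative_singularity w) :=
  @TriangleFunctor (stable c) (relative_singularity w) sloc sloc_shift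
    sloc_shift_nat sloc_dist.

End Equivalence.

Theorem theoremA (T : triangulated) (w : T -> Prop)
    (w_presilting : semi_selforthogonal w)
    (gen_coauslander : forall X : T, trispan (coauslander w) X)
    (gen_auslander : forall X : T, trispan (auslander w) X)
    (c : shift_choice w) :
  triangle_equivalent (stable c) (relative_singularity w).
Proof.
exists (sloc_triangle c); apply: fully_faithful_equivalence => /=.
- move=> A B a; have [f ->] := spi_surj a; rewrite sloc_mapE => f0.
  have lA := auslander_lperp (svalP A).2; have rB := coauslander_rperp (svalP B).1.
  have -> : (0 : shom A B) = spi 0 by apply: (addrI (spi 0)); rewrite -spiD !addr0.
  apply/spiE; rewrite subr0; exact: (loc_faithful w_presilting lA rB).
- move=> [A [cA aA]] [B [cB aB]] a.
  have [f ->] := loc_full w_presilting a (auslander_lperp aA) (coauslander_rperp cB).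
  exists (@spi T w (exist _ A (conj cA aA)) (exist _ B (conj cB aB)) f).
  by rewrite sloc_mapE.
- move=> X; have [A [G [s [t [qs qt gG]]]]] :=
    gorenstein_approximation w_presilting X gen_coauslander gen_auslander.
  exists (exist _ G gG).
  apply: (isomorphic_trans (C := vcat _) (Y := A)); last first.
    by exists (loc _ s); exact: loc_iso.
  by apply: isomorphic_sym; exists (loc _ t); exact: loc_iso.
Qed.
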